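(* Let $F:[0,\infty)\to[0,\infty)$, $F\in C^1([0,\infty))\cap C^2((0,\infty))$, be a strictly convex function such that $F(0)=F'(0)=0$. Set $\Lambda(s)=s\,F''(s)/F'(s)$ for $s>0$ and assume that, for some constants $0<\Lambda^-\le\Lambda^+$, $\Lambda^-\le\Lambda(s)\le\Lambda^+$ for all $s>0$. Assume also that $F'(s)=C\,s^\alpha+o(s^\alpha)$ as $s\to0^+$ for some positive constants $C$ and $\alpha$. Let $\Omega$ be a domain in $\mathbb{C}$ and let $f:\Omega\to\mathbb{C}$ be differentiable in $\Omega$. For $z\in\Omega$ and $r>0$ with $\overline{D_r(z)}\subset\Omega$, let $(a^{\mathcal G}(f,r)(z),b^{\mathcal G}(f,r)(z))$ be the unique minimum point on $\mathbb{C}\times\mathbb{C}$ of $$\mathcal{G}(a,b)=\int_{\partial D_r(z)}\left[F\bigl(|f(\zeta)-a|\bigr)+F\bigl(|f(\zeta)-b\,\overline{(\zeta-z)}|\bigr)\right]dS_\zeta,$$ and set $\mu^{\mathcal G}(f,r)(z)=a^{\mathcal G}(f,r)(z)+r\,b^{\mathcal G}(f,r)(z)$. Then, away from the zeroes of $f$ in $\Omega$, $f$ satisfies the equation $$f_{\overline z}+\frac{\Lambda(|f|)-1}{\Lambda(|f|)+1}\,\frac{f}{\overline f}\,\overline f_{\overline z}=0$$ if and only if it satisfies the asymptotic mean value property $$\mu^{\mathcal G}(f,r)(z)-f(z)=o(r)\quad\text{as } r\to0^+ .$$ That is: the equation holds at every $z\in\Omega$ with $f(z)\ne0$ if and only if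 the asymptotic mean value property holds at every $z\in\Omega$ with $f(z)\neq0$.
   Context: $D_r(z)$ is the disk in $\mathbb{C}$ centered at $z$ with radius $r$; $dS_\zeta$ is the arc-length element. Differentiability is meant in the real sense (as a map from an open subset of $\mathbb{R}^2$ to $\mathbb{R}^2$). With $z=x+iy$: $2f_{\overline z}=f_x+i f_y$, $2f_z=f_x-i f_y$; $\overline f_{\overline z}$ denotes the $\overline z$-derivative of $\overline f$, i.e. $\overline f_{\overline z}=\overline{f_z}$. *)

(* Defs.v *)
From Stdlib Require Import Reals ClassicalEpsilon.
From Coquelicot Require Import Coquelicot.
Open Scope R_scope.

Definition nonneg_half_line (s : R) : Prop := 0 <= s.

(** One-sided at the endpoints of [D], so that values of [g] outside [D] play
    no role. *)
Definition is_derive_within (D : R -> Prop) (g : R -> R) (s l : R) : Prop :=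
  filterdiff g (within D (locally s)) (fun h => scal h l).

Definition strictly_convex_on (D : R -> Prop) (g : R -> R) : Prop :=
  forall s t lam : R, D s -> D t -> s <> t -> 0 < lam < 1 ->
    g (lam * s + (1 - lam) * t) < lam * g s + (1 - lam) * g t.

Definition Lambda (F' F'' : R -> R) (s : R) : R := s * F'' s / F' s.

Definition connected_set (Omega : C -> Prop) : Prop :=
  forall U V : C -> Prop, open U -> open V ->
    (forall z, Omega z -> U z \/ V z) ->
    (exists z, Omega z /\ U z) ->
    (exists z, Omega z /\ V z) ->
    exists z, Omega z /\ U z /\ V z.

Definition complex_domain (Omega : C -> Prop) : Prop :=
  open Omega /\ (exists z, Omega z) /\ connected_set Omega.

(** The linear structure on [C] is the one over [R]: this is differentiability
    of a map of the plane, not holomorphy. *)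
Definition real_differentiable (f : C -> C) (z : C) : Prop :=
  @ex_filterdiff R_AbsRing C_R_NormedModule C_R_NormedModule f (locally z).

Definition partial_x (f : C -> C) (z : C) : C :=
  (Derive (fun x => Re (f (x, Im z))) (Re z),
   Derive (fun x => Im (f (x, Im z))) (Re z)).

Definition partial_y (f : C -> C) (z : C) : C :=
  (Derive (fun y => Re (f (Re z, y))) (Im z),
   Derive (fun y => Im (f (Re z, y))) (Im z)).

Definition d_zbar (f : C -> C) (z : C) : C :=
  ((partial_x f z + Ci * partial_y f z) / 2)%C.

(** Integral over the circle of centre [z] and radius [r] with respect to arc
    length, through the parametrization by the angle. *)
Definition circle_integral (z : C) (r : R) (g : C -> R) : R :=
  RInt (fun t => g (z + r * (cos t, sin t))%C * r) 0 (2 * PI).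

Definition Gfun (F : R -> R) (f : C -> C) (r : R) (z : C) (p : C * C) : R :=
  circle_integral z r (fun zeta =>
    F (Cmod (f zeta - fst p)) + F (Cmod (f zeta - snd p * Cconj (zeta - z)))).

Definition is_min_point {T : Type} (G : T -> R) (p : T) : Prop :=
  forall q : T, G p <= G q.

(** Definite description: the unique minimum point when there is exactly one,
    and an unspecified pair otherwise. *)
Definition argminG (F : R -> R) (f : C -> C) (r : R) (z : C) : C * C :=
  epsilon (inhabits (RtoC 0, RtoC 0)) (unique (is_min_point (Gfun F f r z))).

Definition muG (F : R -> R) (f : C -> C) (r : R) (z : C) : C :=
  (fst (argminG F f r z) + r * snd (argminG F f r z))%C.

(** At an interior point [z] of the set where [f] is considered, only radii
    whose closed disk lies in that set matter here, the property being
    asymptotic as [r] tends to [0]. *)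
Definition asymptotic_mvp (F : R -> R) (f : C -> C) (z : C) : Prop :=
  forall eps : posreal,
    at_right 0 (fun r => Cmod (muG F f r z - f z) <= eps * r).

Definition satisfies_equation (F' F'' : R -> R) (f : C -> C) (z : C) : Prop :=
  (d_zbar f z
   + RtoC ((Lambda F' F'' (Cmod (f z)) - 1) / (Lambda F' F'' (Cmod (f z)) + 1))
     * (f z / Cconj (f z)) * d_zbar (fun w => Cconj (f w)) z = 0)%C.

(* Main.v *)
Require Import Defs.
From Stdlib Require Import Reals Lra Classical ClassicalEpsilon.
From Coquelicot Require Import Coquelicot.
Open Scope R_scope.

(** The proof is pointwise. At every [z] of the domain with [w0 = f z] nonzero,
    the mean has the expansion
      [mu (f, r) (z) = f z + r * g0 + o (r)],
    where [g0] is the left-hand side of the equation at [z]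
    (lemma [mean_value_expansion]). The asymptotic mean value property at [z] is
    therefore equivalent to [g0 = 0].

    Write [f (z + h) = w0 + A h + B conj h + o (|h|)]. The functional splits as a
    sum of a function of [a] and a function of [b], each an integral over the
    unit circle of [F] of the modulus of an affine function of the unknown. Each
    is strictly convex, so it is enough to compare its values on two concentric
    circles about the expected minimum point: if, on every ray from the centre,
    the value at distance [2 e] exceeds the value at distance [e], there is a
    unique minimum point and it lies within [2 e] of the centre
    (lemma [unique_min_near]). The comparison follows from the subgradient
    inequality for [w |-> F |w|], with gradient [H w = F' (|w|) w / |w|],
    integrated over the circle; the integral is handled by averaging the
    integrand over the four quarter turns of the circle.

    For [a], with centre [w0] and radius [r e], the values of [f] at opposite
    points of the circle are symmetric about [w0] up to [o (r)], and the
    comparison follows from a scale-invariant strict monotonicity of [H], which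
    is where the bounds on [Lambda] enter (lemmas
    [radial_grad_uniform_monotone], [constant_fit_descent]). Hence
    [a = w0 + o (r)].

    For [b], with centre [g0], the gradient [H] is replaced by its first-order
    expansion at [w0], whose linear part is
      [v |-> P v + Q (w0 / conj w0) conj v],
      [P = (F'' + F' / s) / 2], [Q = (F'' - F' / s) / 2], [s = |w0|].
    After averaging over quarter turns only the coefficient of [conj u]
    survives, where [u] is the point of the unit circle, and it vanishes for
      [b = B + (Q / P) (w0 / conj w0) conj A],
    which is [g0] since [Q / P = (Lambda - 1) / (Lambda + 1)]
    (lemmas [radial_grad_expansion], [linear_fit_descent]). Hence
    [b = g0 + o (1)]. *)

(** * The Euclidean structure of the plane *)

(** The real scalar product, the real part of [v conj w]. *)
Definition dot (v w : C) : R := Re v * Re w + Im v * Im w.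

Lemma C_eq (v w : C) : Re v = Re w -> Im v = Im w -> v = w.
Proof. destruct v, w; simpl; congruence. Qed.

Lemma Cmod_sqr (v : C) : Cmod v * Cmod v = Re v * Re v + Im v * Im v.
Proof. generalize (Cmod2_alt v); lra. Qed.

Lemma Cmod_le_of_sqr (v : C) (a : R) : 0 <= a -> dot v v <= a * a -> Cmod v <= a.
Proof.
  intros Ha H. apply Rsqr_incr_0_var; [|exact Ha].
  unfold Rsqr. rewrite Cmod_sqr. exact H.
Qed.

Lemma dot_le_Cmod (v w : C) : dot v w <= Cmod v * Cmod w.
Proof.
  apply Rsqr_incr_0_var.
  - unfold Rsqr.
    replace (Cmod v * Cmod w * (Cmod v * Cmod w))
      with ((Cmod v * Cmod v) * (Cmod w * Cmod w)) by ring.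
    rewrite !Cmod_sqr. unfold dot.
    generalize (Rle_0_sqr (Re v * Im w - Im v * Re w)). unfold Rsqr. lra.
  - apply Rmult_le_pos; apply Cmod_ge_0.
Qed.

Lemma dot_opp_l (v w : C) : dot (- v)%C w = - dot v w.
Proof. unfold dot, Re, Im; simpl; ring. Qed.

Lemma dot_ge_opp_Cmod (v w : C) : - (Cmod v * Cmod w) <= dot v w.
Proof.
  generalize (dot_le_Cmod (- v)%C w). rewrite dot_opp_l, Cmod_opp. lra.
Qed.

Lemma Cmod_minus_sym (v w : C) : Cmod (v - w) = Cmod (w - v).
Proof. rewrite <- Cmod_opp. replace (- (v - w))%C with (w - v)%C by ring. reflexivity. Qed.

Lemma Cmod_triangle_rev (v w : C) : Rabs (Cmod v - Cmod w) <= Cmod (v - w).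
Proof.
  generalize (Cmod_triangle (v - w) w), (Cmod_triangle (w - v) v).
  rewrite (Cmod_minus_sym w v).
  replace (v - w + w)%C with v by ring. replace (w - v + v)%C with w by ring.
  intros. apply Rabs_le. lra.
Qed.

Lemma Cmod_real_mult (r : R) (v : C) : 0 <= r -> Cmod (RtoC r * v) = r * Cmod v.
Proof. intros. rewrite Cmod_mult, Cmod_R, Rabs_right; lra. Qed.

Lemma Cmod_sqr_convex (v w : C) (lam : R) :
  Cmod (RtoC lam * v + RtoC (1 - lam) * w) * Cmod (RtoC lam * v + RtoC (1 - lam) * w)
  = lam * (Cmod v * Cmod v) + (1 - lam) * (Cmod w * Cmod w)
    - lam * (1 - lam) * (Cmod (v - w) * Cmod (v - w)).
Proof. rewrite !Cmod_sqr. unfold Re, Im; simpl; ring. Qed.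

(** * Convex radial weights *)

(** The properties of [F] and of its derivative that the minimization arguments
    use; [F] is relevant on the nonnegative half-line only. *)
Record weight (F F' : R -> R) : Prop := {
  weight_0 : F 0 = 0;
  weight_deriv_0 : F' 0 = 0;
  weight_deriv_pos : forall s, 0 < s -> 0 < F' s;
  weight_deriv_incr : forall s t, 0 <= s <= t -> F' s <= F' t;
  weight_tangent : forall s t, 0 <= s -> 0 <= t -> F s + F' s * (t - s) <= F t;
  weight_strict : strictly_convex_on nonneg_half_line F }.

(** The derivative is one-sided when [s = 0]. *)
Lemma convex_tangent (F : R -> R) (s t d : R) :
  strictly_convex_on nonneg_half_line F -> 0 <= s -> 0 <= t ->
  is_derive_within nonneg_half_line F s d -> F s + d * (t - s) <= F t.
Proof.
  intros HF Hs Ht [_ Hd].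
  destruct (Req_dec s t) as [->|Hst]; [lra|].
  apply le_epsilon. intros eps Heps.
  assert (Hp : 0 < Rabs (t - s)) by (apply Rabs_pos_lt; lra).
  assert (He : 0 < eps / Rabs (t - s)) by (apply Rdiv_lt_0_compat; lra).
  assert (Hlim : is_filter_lim (within nonneg_half_line (locally s)) s).
  { intros P HP. apply filter_le_within. exact HP. }
  destruct (Hd s Hlim (mkposreal _ He)) as [del Hdel]. simpl in Hdel.
  (* [lam] is so small that [y] lies where the first-order expansion holds *)
  pose (lam := Rmin (1 / 2) (del / 2 / Rabs (t - s))).
  assert (Hl : 0 < lam < 1).
  { split; [apply Rmin_glb_lt; [lra|]|].
    - apply Rdiv_lt_0_compat; [generalize (cond_pos del)|]; lra.
    - eapply Rle_lt_trans; [apply Rmin_l|lra]. }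
  pose (y := lam * t + (1 - lam) * s).
  assert (Hys : y - s = lam * (t - s)) by (unfold y; ring).
  assert (Hld : lam * Rabs (t - s) < del).
  { apply Rle_lt_trans with (del / 2 / Rabs (t - s) * Rabs (t - s)).
    - apply Rmult_le_compat_r; [lra|apply Rmin_r].
    - field_simplify; [|lra]. generalize (cond_pos del); lra. }
  assert (Hy : ball s del y).
  { change (Rabs (y - s) < del). rewrite Hys, Rabs_mult, (Rabs_right lam); lra. }
  assert (Hy0 : nonneg_half_line y).
  { unfold nonneg_half_line, y. apply Rplus_le_le_0_compat; apply Rmult_le_pos; lra. }
  specialize (Hdel y Hy Hy0).
  change (Rabs (F y - F s - (y - s) * d)
          <= eps / Rabs (t - s) * Rabs (y - s)) in Hdel.
  rewrite Hys, Rabs_mult, (Rabs_right lam) in Hdel by lra.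
  replace (eps / Rabs (t - s) * (lam * Rabs (t - s))) with (lam * eps) in Hdel
    by (field; lra).
  assert (Hc : F y < lam * F t + (1 - lam) * F s) by (apply HF; auto).
  apply Rabs_le_between in Hdel.
  apply Rmult_le_reg_l with lam; [lra|].
  rewrite Rmult_plus_distr_l. nra.
Qed.

Lemma weight_intro (F F' : R -> R)
  (F_nonneg : forall s, 0 <= s -> 0 <= F s)
  (F_derive : forall s, 0 <= s ->
     is_derive_within nonneg_half_line F s (F' s))
  (F_convex : strictly_convex_on nonneg_half_line F)
  (F_0 : F 0 = 0) (F'_0 : F' 0 = 0) :
  weight F F'.
Proof.
  assert (Htan : forall s t, 0 <= s -> 0 <= t -> F s + F' s * (t - s) <= F t)
    by (intros; apply convex_tangent; auto).
  assert (Fpos : forall s, 0 < s -> 0 < F s).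
  { intros s Hs.
    generalize (F_convex s 0 (1/2) (Rlt_le _ _ Hs) (Rle_refl 0)).
    intros H. assert (H1 := H ltac:(lra) ltac:(lra)).
    generalize (F_nonneg (1 / 2 * s + (1 - 1 / 2) * 0)). lra. }
  assert (F'pos : forall s, 0 < s -> 0 < F' s).
  { intros s Hs. generalize (Htan s 0 ltac:(lra) (Rle_refl 0)) (Fpos s Hs). nra. }
  split; auto.
  intros s t [Hs Hst]. destruct (Req_dec s t) as [->|Hne]; [lra|].
  (* the two tangent inequalities, added *)
  generalize (Htan s t Hs ltac:(lra)) (Htan t s ltac:(lra) Hs). nra.
Qed.

Section Weight.
Context {F F' : R -> R} (W : weight F F').

Lemma weight_nonneg (s : R) : 0 <= s -> 0 <= F s.
Proof.
  intros Hs. generalize (weight_tangent _ _ W 0 s (Rle_refl _) Hs).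
  rewrite (weight_0 _ _ W), (weight_deriv_0 _ _ W). lra.
Qed.

Lemma weight_deriv_nonneg (s : R) : 0 <= s -> 0 <= F' s.
Proof.
  intros Hs. rewrite <- (weight_deriv_0 _ _ W). apply (weight_deriv_incr _ _ W); lra.
Qed.

Lemma weight_incr (s t : R) : 0 <= s < t -> F s < F t.
Proof.
  intros [Hs Hst].
  assert (Hm : 0 < (s + t) / 2) by lra.
  generalize (weight_tangent _ _ W ((s+t)/2) t ltac:(lra) ltac:(lra)).
  generalize (weight_tangent _ _ W s ((s+t)/2) ltac:(lra) ltac:(lra)).
  generalize (weight_deriv_pos _ _ W _ Hm) (weight_deriv_nonneg s Hs). nra.
Qed.

Lemma weight_incr_le (s t : R) : 0 <= s <= t -> F s <= F t.
Proof.
  intros [Hs [Hst| ->]]; [|lra]. apply Rlt_le, weight_incr; lra.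
Qed.

Lemma weight_lipschitz (M s t : R) :
  0 <= s <= M -> 0 <= t <= M -> Rabs (F s - F t) <= F' M * Rabs (s - t).
Proof.
  assert (H : forall s t, 0 <= s <= M -> 0 <= t <= s ->
             Rabs (F s - F t) <= F' M * Rabs (s - t)).
  { clear s t. intros s t Hs Ht.
    rewrite !Rabs_right; [| lra | generalize (weight_incr_le t s); lra].
    generalize (weight_tangent _ _ W s t ltac:(lra) ltac:(lra)).
    generalize (weight_deriv_incr _ _ W s M ltac:(lra)). nra. }
  intros Hs Ht. destruct (Rle_dec t s).
  - apply H; lra.
  - rewrite Rabs_minus_sym, (Rabs_minus_sym s). apply H; lra.
Qed.

Lemma radial_lipschitz (M : R) (v w : C) : Cmod v <= M -> Cmod w <= M ->
  Rabs (F (Cmod v) - F (Cmod w)) <= F' M * Cmod (v - w).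
Proof.
  intros Hv Hw. generalize (Cmod_ge_0 v) (Cmod_ge_0 w). intros.
  eapply Rle_trans; [apply weight_lipschitz; split; eassumption|].
  apply Rmult_le_compat_l; [apply weight_deriv_nonneg; lra|].
  apply Cmod_triangle_rev.
Qed.

Lemma radial_strictly_convex (v w : C) (lam : R) : v <> w -> 0 < lam < 1 ->
  F (Cmod (RtoC lam * v + RtoC (1 - lam) * w))
    < lam * F (Cmod v) + (1 - lam) * F (Cmod w).
Proof.
  intros Hvw Hl.
  assert (Htri : Cmod (RtoC lam * v + RtoC (1 - lam) * w)
                 <= lam * Cmod v + (1 - lam) * Cmod w).
  { eapply Rle_trans; [apply Cmod_triangle|]. rewrite !Cmod_real_mult; lra. }
  destruct (Req_dec (Cmod v) (Cmod w)) as [E|E].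
  - (* equal moduli: the convex combination is strictly inside the disk *)
    assert (Hlt : Cmod (RtoC lam * v + RtoC (1 - lam) * w) < Cmod w).
    { destruct (Rle_lt_or_eq_dec (Cmod (RtoC lam * v + RtoC (1 - lam) * w)) (Cmod w))
        as [L|Q]; auto; [nra|exfalso].
      assert (Hd : 0 < Cmod (v - w) * Cmod (v - w)).
      { assert (0 < Cmod (v - w)); [|nra]. apply Cmod_gt_0. intro Z. apply Hvw.
        replace v with (v - w + w)%C by ring. rewrite Z. ring. }
      assert (Q2 : Cmod (RtoC lam * v + RtoC (1 - lam) * w)
                   * Cmod (RtoC lam * v + RtoC (1 - lam) * w) = Cmod w * Cmod w)
        by (rewrite Q; reflexivity).
      assert (E2 : Cmod v * Cmod v = Cmod w * Cmod w) by (rewrite E; reflexivity).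
      rewrite Cmod_sqr_convex, E2 in Q2.
      generalize (Rmult_lt_0_compat (lam * (1 - lam)) _
                    ltac:(apply Rmult_lt_0_compat; lra) Hd). lra. }
    rewrite E. generalize (weight_incr _ _ (conj (Cmod_ge_0 _) Hlt)). lra.
  - eapply Rle_lt_trans.
    + apply weight_incr_le. split; [apply Cmod_ge_0|exact Htri].
    + apply (weight_strict _ _ W); auto; apply Cmod_ge_0.
Qed.

End Weight.

(** The gradient of [w |-> F |w|]; at the origin it is [0], whatever the value
    of the division by zero. *)
Definition radial_grad (F' : R -> R) (w : C) : C :=
  (RtoC (F' (Cmod w) / Cmod w) * w)%C.

Lemma radial_subgradient (F F' : R -> R) (w w' : C) : weight F F' ->
  F (Cmod w) + dot (radial_grad F' w) (w' - w) <= F (Cmod w').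
Proof.
  intros W. unfold radial_grad.
  generalize (Cmod_ge_0 w) (Cmod_ge_0 w'). intros H H'.
  assert (E : dot (RtoC (F' (Cmod w) / Cmod w) * w) (w' - w)
              = F' (Cmod w) / Cmod w * dot w (w' - w)) by (unfold dot, Re, Im; simpl; ring).
  rewrite E. destruct (Req_dec (Cmod w) 0) as [Z|Z].
  - rewrite Z, (weight_deriv_0 _ _ W), (weight_0 _ _ W).
    generalize (weight_nonneg W _ H'). unfold Rdiv. lra.
  - eapply Rle_trans; [|apply (weight_tangent _ _ W _ _ H H')].
    apply Rplus_le_compat_l. unfold Rdiv. rewrite Rmult_assoc.
    apply Rmult_le_compat_l; [apply (weight_deriv_nonneg W); lra|].
    apply Rmult_le_reg_l with (Cmod w); [lra|].
    rewrite <- Rmult_assoc, Rinv_r, Rmult_1_l by exact Z.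
    replace (dot w (w' - w)) with (dot w w' - Cmod w * Cmod w)
      by (rewrite Cmod_sqr; unfold dot, Re, Im; simpl; ring).
    generalize (dot_le_Cmod w w'). lra.
Qed.

Lemma radial_grad_Cmod (F F' : R -> R) (w : C) : weight F F' ->
  Cmod (radial_grad F' w) = F' (Cmod w).
Proof.
  intros W. unfold radial_grad. destruct (Req_dec (Cmod w) 0) as [Z|Z].
  - rewrite (Cmod_eq_0 _ Z), Cmod_0, (weight_deriv_0 _ _ W), Cmult_0_r. apply Cmod_0.
  - generalize (Cmod_ge_0 w). intros. rewrite Cmod_real_mult; [field; auto|].
    apply Rlt_le, Rdiv_lt_0_compat; [apply (weight_deriv_pos _ _ W)|]; lra.
Qed.

(** * Minimization of strictly convex functions on the plane *)

Definition strictly_convex_plane (J : C -> R) : Prop :=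
  forall (v w : C) (lam : R), v <> w -> 0 < lam < 1 ->
    J (RtoC lam * v + RtoC (1 - lam) * w)%C < lam * J v + (1 - lam) * J w.

(** Lipschitz on every bounded set. *)
Definition locally_lipschitz (J : C -> R) : Prop :=
  forall K : R, exists L : R, 0 <= L /\
    forall v w : C, Cmod v <= K -> Cmod w <= K ->
      Rabs (J v - J w) <= L * Cmod (v - w).

(** The closed square of centre [c] and half-side [e]. *)
Definition in_square (c : C) (e : R) (y : C) : Prop :=
  Rabs (Re y - Re c) <= e /\ Rabs (Im y - Im c) <= e.

Lemma Cmod_le_sum (v : C) : Cmod v <= Rabs (Re v) + Rabs (Im v).
Proof.
  generalize (Rabs_pos (Re v)) (Rabs_pos (Im v)). intros.
  apply Cmod_le_of_sqr; [lra|].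
  assert (Rabs (Re v) * Rabs (Re v) = Re v * Re v)
    by (rewrite <- Rabs_mult; apply Rabs_right; nra).
  assert (Rabs (Im v) * Rabs (Im v) = Im v * Im v)
    by (rewrite <- Rabs_mult; apply Rabs_right; nra).
  unfold dot. nra.
Qed.

Lemma in_square_Cmod (c y : C) (e : R) :
  in_square c e y -> Cmod y <= Cmod c + 2 * e.
Proof.
  intros [H1 H2]. replace y with (y - c + c)%C by ring.
  eapply Rle_trans; [apply Cmod_triangle|].
  generalize (Cmod_le_sum (y - c)).
  change (Re (y - c)) with (Re y - Re c). change (Im (y - c)) with (Im y - Im c). lra.
Qed.

Lemma exists_min_square (J : C -> R) (c : C) (e : R) :
  locally_lipschitz J -> 0 <= e ->
  exists m, in_square c e m /\ forall y, in_square c e y -> J m <= J y.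
Proof.
  intros HJ He. destruct (HJ (Cmod c + 2 * e)) as [L [HL Hlip]].
  assert (Hc : in_square c e c).
  { split; rewrite Rminus_diag_eq, Rabs_R0; auto. }
  assert (Hcc := in_square_Cmod _ _ _ Hc).
  pose (E := fun x => exists y, in_square c e y /\ x = - J y).
  assert (HE : bound E).
  { exists (- J c + L * (2 * Cmod c + 2 * e)). intros x [y [Hy ->]].
    assert (Hyc := in_square_Cmod _ _ _ Hy).
    generalize (Hlip c y Hcc Hyc). intros H. apply Rabs_le_between in H.
    generalize (Cmod_triangle c (- y)). rewrite Cmod_opp.
    change (c + - y)%C with (c - y)%C. intros H1.
    assert (L * Cmod (c - y) <= L * (2 * Cmod c + 2 * e))
      by (apply Rmult_le_compat_l; lra). lra. }
  destruct (completeness E HE (ex_intro _ _ (ex_intro _ c (conj Hc eq_refl))))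
    as [s [Hub Hlub]].
  destruct (excluded_middle_informative
              (exists m, in_square c e m /\ J m <= - s)) as [[m [Hm HmJ]]|Hno].
  { exists m. split; auto. intros y Hy.
    generalize (Hub (- J y) (ex_intro _ y (conj Hy eq_refl))). lra. }
  exfalso.
  assert (Hgap : forall y, in_square c e y -> 0 < J y + s).
  { intros y Hy. apply Rnot_le_lt. intro H. apply Hno. exists y. split; auto. lra. }
  (* around each point, a radius on which [J] stays above its infimum [- s] by
     at least that radius *)
  pose (delta := fun u v : R =>
    match Rlt_dec 0 ((J (u, v) + s) / (2 * L + 1)) with
    | left p => mkposreal _ p | right _ => mkposreal 1 Rlt_0_1 end).
  assert (Hdelta : forall u v, in_square c e (u, v) ->
            (2 * L + 1) * delta u v = J (u, v) + s).
  { intros u v H. unfold delta. destruct (Rlt_dec _ _) as [p|p]; simpl.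
    - field. lra.
    - exfalso. apply p, Rdiv_lt_0_compat; [auto|lra]. }
  destruct (compactness_value_2d (Re c - e) (Re c + e) (Im c - e) (Im c + e) delta)
    as [d Hd].
  assert (Hs : is_upper_bound E (s - d)).
  { intros x [y [Hy ->]]. apply Rnot_lt_le. intro Hlt.
    assert (Hy' := Hy). destruct Hy' as [Hy1 Hy2].
    apply Rabs_le_between in Hy1. apply Rabs_le_between in Hy2.
    apply (Hd (Re y) (Im y)); [lra|lra|].
    intros [u [v [Hu [Hv [Hyu [Hyv Hdd]]]]]].
    assert (Huv : in_square c e (u, v)).
    { split; simpl; apply Rabs_le; lra. }
    generalize (Hdelta u v Huv)
      (Hlip (u, v) y (in_square_Cmod _ _ _ Huv) (in_square_Cmod _ _ _ Hy)).
    intros H1 H2. apply Rabs_le_between in H2.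
    generalize (Cmod_le_sum ((u, v) - y)).
    change (Re ((u, v) - y)) with (u - Re y). change (Im ((u, v) - y)) with (v - Im y).
    rewrite (Rabs_minus_sym u), (Rabs_minus_sym v). intros H3.
    assert (L * Cmod ((u, v) - y) <= L * (2 * delta u v))
      by (apply Rmult_le_compat_l; lra).
    lra. }
  generalize (Hlub _ Hs) (cond_pos d). lra.
Qed.

(** If, on every ray from [c], the value of [J] at distance [2 * e] exceeds its
    value at distance [e], convexity keeps [J] from coming back down farther
    out, and the minimum over the larger disk is global. *)
Lemma unique_min_near (J : C -> R) (c : C) (e : R) :
  strictly_convex_plane J -> locally_lipschitz J -> 0 < e ->
  (forall d, Cmod d = e -> J (c + d)%C < J (c + RtoC 2 * d)%C) ->
  exists m, unique (is_min_point J) m /\ Cmod (m - c) <= 2 * e.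
Proof.
  intros Hconv Hlip He Hout.
  assert (Hfar : forall y, 2 * e < Cmod (y - c) ->
            exists x, Cmod (x - c) <= 2 * e /\ J x < J y).
  { intros y Hy. set (rho := Cmod (y - c)) in *.
    pose (d := (RtoC (e / rho) * (y - c))%C).
    assert (Hd : Cmod d = e).
    { unfold d. rewrite Cmod_real_mult; [fold rho; field; lra|].
      apply Rlt_le, Rdiv_lt_0_compat; lra. }
    exists (c + d)%C. split.
    { replace (c + d - c)%C with d by ring. lra. }
    specialize (Hout d Hd).
    (* the weight for which [c + 2 d] is the combination of [c + d] and [y] *)
    pose (lam := (rho - 2 * e) / (rho - e)).
    assert (Hlam : 0 < lam < 1).
    { unfold lam. split; [apply Rdiv_lt_0_compat; lra|].
      apply Rmult_lt_reg_r with (rho - e); [lra|]. field_simplify; lra. }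
    assert (Hne : (c + d)%C <> y).
    { intro E. assert (rho = e); [|lra]. unfold rho. rewrite <- E, <- Hd.
      f_equal. ring. }
    generalize (Hconv _ _ lam Hne Hlam).
    replace (RtoC lam * (c + d) + RtoC (1 - lam) * y)%C with (c + RtoC 2 * d)%C; [nra|].
    unfold d, lam. destruct c as [c1 c2], y as [y1 y2].
    apply C_eq; unfold Re, Im; simpl; field; lra. }
  destruct (exists_min_square J c (2 * e) Hlip ltac:(lra)) as [m [Hm Hmin]].
  assert (Hin : forall y, Cmod (y - c) <= 2 * e -> in_square c (2 * e) y).
  { intros y Hy. split.
    - eapply Rle_trans; [apply (re_le_Cmod (y - c))|exact Hy].
    - eapply Rle_trans; [|exact Hy]. eapply Rle_trans; [|apply Rmax_Cmod].
      apply (Rmax_r (Rabs (fst (y - c)%C))). }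
  assert (Hmd : Cmod (m - c) <= 2 * e).
  { apply Rnot_lt_le. intro H. destruct (Hfar m H) as [x [Hx Hxm]].
    generalize (Hmin x (Hin x Hx)). lra. }
  assert (Hglob : is_min_point J m).
  { intros y. destruct (Rle_dec (Cmod (y - c)) (2 * e)) as [H|H]; [auto|].
    destruct (Hfar y) as [x [Hx Hxy]]; [lra|].
    generalize (Hmin x (Hin x Hx)). lra. }
  exists m. split; [split; auto|exact Hmd].
  intros m' Hm'. apply NNPP. intro Hne.
  generalize (Hconv m m' (1 / 2) Hne ltac:(lra))
    (Hglob (RtoC (1/2) * m + RtoC (1 - 1/2) * m')%C) (Hm' m). lra.
Qed.

(** * Radial energies on the unit circle *)

Definition continuous_curve (g : R -> C) : Prop :=
  forall t, continuous (fun x => Re (g x)) t /\ continuous (fun x => Im (g x)) t.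

Lemma continuous_curve_minus (g h : R -> C) :
  continuous_curve g -> continuous_curve h ->
  continuous_curve (fun t => g t - h t)%C.
Proof.
  intros Hg Hh t. destruct (Hg t), (Hh t).
  split; unfold Cminus, Cplus, Copp, Re, Im in *; simpl;
    apply @continuous_minus; auto.
Qed.

Lemma continuous_curve_scale (a : C) (g : R -> C) :
  continuous_curve g -> continuous_curve (fun t => a * g t)%C.
Proof.
  intros Hg t. destruct (Hg t) as [H1 H2].
  split; unfold Re, Im in *; simpl;
    [apply @continuous_minus | apply @continuous_plus];
    apply @continuous_mult; auto; apply continuous_const.
Qed.

Lemma continuous_radial_curve (F F' : R -> R) (g : R -> C) :
  weight F F' -> continuous_curve g ->
  forall t, continuous (fun x => F (Cmod (g x))) t.
Proof.
  intros W Hg t. destruct (Hg t) as [H1 H2].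
  pose (M := Cmod (g t) + 1).
  assert (HL : 0 <= F' M).
  { apply (weight_deriv_nonneg W). unfold M. generalize (Cmod_ge_0 (g t)). lra. }
  apply filterlim_locally. intros eps.
  assert (He : 0 < Rmin (1 / 2) (eps / (2 * (F' M + 1)))).
  { apply Rmin_glb_lt; [lra|]. apply Rdiv_lt_0_compat; [apply cond_pos|lra]. }
  generalize (filter_and _ _ (proj1 (filterlim_locally _ _) H1 (mkposreal _ He))
    (proj1 (filterlim_locally _ _) H2 (mkposreal _ He))).
  apply filter_imp. intros x [Hx1 Hx2].
  change (Rabs (Im (g x) - Im (g t)) < Rmin (1 / 2) (eps / (2 * (F' M + 1)))) in Hx2.
  change (Rabs (Re (g x) - Re (g t)) < Rmin (1 / 2) (eps / (2 * (F' M + 1)))) in Hx1.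
  change (Rabs (F (Cmod (g x)) - F (Cmod (g t))) < eps).
  assert (Hd : Cmod (g x - g t) < 2 * Rmin (1 / 2) (eps / (2 * (F' M + 1)))).
  { generalize (Cmod_le_sum (g x - g t)).
    change (Re (g x - g t)) with (Re (g x) - Re (g t)).
    change (Im (g x - g t)) with (Im (g x) - Im (g t)). lra. }
  generalize (Rmin_l (1 / 2) (eps / (2 * (F' M + 1))))
    (Rmin_r (1 / 2) (eps / (2 * (F' M + 1)))). intros Hl Hr.
  assert (Hx : Cmod (g x) <= M).
  { generalize (Cmod_triangle (g x - g t) (g t)).
    replace (g x - g t + g t)%C with (g x) by ring. unfold M. lra. }
  eapply Rle_lt_trans; [apply (radial_lipschitz W M); [exact Hx|unfold M; lra]|].
  apply Rle_lt_trans with ((F' M + 1) * Cmod (g x - g t)).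
  { apply Rmult_le_compat_r; [apply Cmod_ge_0|lra]. }
  apply Rlt_le_trans with ((F' M + 1) * (2 * (eps / (2 * (F' M + 1))))).
  { apply Rmult_lt_compat_l; lra. }
  right. field. lra.
Qed.

Lemma Cmod_circle (t : R) : Cmod (cos t, sin t) = 1.
Proof.
  unfold Cmod; simpl. transitivity (sqrt 1); [|apply sqrt_1]. apply (f_equal sqrt).
  generalize (sin2_cos2 t). unfold Rsqr. lra.
Qed.

Lemma ex_RInt_continuous_all (g : R -> R) (a b : R) :
  (forall t, continuous g t) -> ex_RInt g a b.
Proof. intros H. apply @ex_RInt_continuous. auto. Qed.

Lemma RInt_lincomb (g h : R -> R) (l m a b : R) :
  (forall t, continuous g t) -> (forall t, continuous h t) ->
  l * RInt g a b + m * RInt h a b = RInt (fun t => l * g t + m * h t) a b.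
Proof.
  intros Hg Hh.
  assert (Ig := ex_RInt_continuous_all g a b Hg).
  assert (Ih := ex_RInt_continuous_all h a b Hh).
  symmetry. apply is_RInt_unique.
  apply (is_RInt_plus (V := R_NormedModule) (fun t => l * g t) (fun t => m * h t));
    apply (is_RInt_scal (V := R_NormedModule)); apply (@RInt_correct R_CompleteNormedModule);
    assumption.
Qed.

Lemma RInt_shift (g : R -> R) (v a b : R) : (forall t, continuous g t) ->
  RInt g (a + v) (b + v) = RInt (fun t => g (t + v)) a b.
Proof.
  intros Hg.
  generalize (RInt_comp_lin g 1 v a b (ex_RInt_continuous_all _ _ _ Hg)).
  rewrite !Rmult_1_l. intros <-. apply RInt_ext. intros x _.
  change (1 * g (1 * x + v) = g (x + v)). rewrite !Rmult_1_l. reflexivity.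
Qed.

(** Averaging over the four quarter turns removes every Fourier mode whose
    frequency is not a multiple of four, so that the sum below can be positive
    where the integrand is not. *)
Lemma RInt_circle_pos (q : C -> R) :
  (forall t, continuous (fun x => q (cos x, sin x)) t) ->
  (forall u, Cmod u = 1 ->
     0 < q u + q (- u)%C + (q (Ci * u)%C + q (- (Ci * u))%C)) ->
  0 < RInt (fun t => q (cos t, sin t)) 0 (2 * PI).
Proof.
  intros Hc Hpos. set (g := fun t => q (cos t, sin t)) in *.
  assert (Hcs : forall v t, continuous (fun x => g (x + v)) t).
  { intros v t. apply (continuous_comp (fun x => x + v) g); [|apply Hc].
    apply @continuous_plus; [apply continuous_id|apply continuous_const]. }
  assert (HI : forall v, ex_RInt (fun x => g (x + v)) 0 (PI / 2))
    by (intros; apply ex_RInt_continuous_all; auto).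
  assert (HI0 : forall a b, ex_RInt g a b)
    by (intros; apply ex_RInt_continuous_all; auto).
  assert (Hch : forall a b c, RInt g a b + RInt g b c = RInt g a c)
    by (intros; apply (RInt_Chasles g); auto).
  assert (E : RInt g 0 (2 * PI)
     = RInt (fun t : R => g (t + 0) + g (t + PI) + (g (t + PI / 2) + g (t + 3 * (PI / 2))))
         0 (PI / 2)).
  { rewrite (RInt_plus (fun t => g (t + 0) + g (t + PI))
               (fun t => g (t + PI / 2) + g (t + 3 * (PI / 2)))).
    2: apply @ex_RInt_plus; auto. 2: apply @ex_RInt_plus; auto.
    rewrite (RInt_plus (fun t => g (t + 0)) (fun t => g (t + PI))); auto.
    rewrite (RInt_plus (fun t => g (t + PI / 2)) (fun t => g (t + 3 * (PI / 2)))); auto.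
    rewrite <- !RInt_shift by exact Hc.
    change (RInt g 0 (2 * PI) = RInt g (0 + 0) (PI / 2 + 0) + RInt g (0 + PI) (PI / 2 + PI)
      + (RInt g (0 + PI / 2) (PI / 2 + PI / 2)
         + RInt g (0 + 3 * (PI / 2)) (PI / 2 + 3 * (PI / 2)))).
    replace (0 + 0) with 0 by ring. replace (PI / 2 + 0) with (PI / 2) by ring.
    replace (0 + PI / 2) with (PI / 2) by ring. replace (PI / 2 + PI / 2) with PI by field.
    replace (0 + PI) with PI by ring.
    replace (PI / 2 + PI) with (3 * (PI / 2)) by field.
    replace (0 + 3 * (PI / 2)) with (3 * (PI / 2)) by ring.
    replace (PI / 2 + 3 * (PI / 2)) with (2 * PI) by field.
    rewrite <- (Hch 0 PI (2 * PI)), <- (Hch 0 (PI / 2) PI),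
      <- (Hch PI (3 * (PI / 2)) (2 * PI)).
    match goal with |- @eq _ ?x ?y => change (@eq R x y) end. ring. }
  rewrite E. apply RInt_gt_0; [generalize PI_RGT_0; lra| |].
  - intros t _. specialize (Hpos (cos t, sin t) (Cmod_circle t)). unfold g.
    replace (t + 0) with t by ring.
    replace (t + 3 * (PI / 2)) with (t + PI / 2 + PI) by field.
    rewrite !neg_cos, !neg_sin, cos_plus, sin_plus, cos_PI2, sin_PI2.
    replace (Ci * (cos t, sin t))%C with (- sin t, cos t) in Hpos
      by (apply C_eq; unfold Re, Im; simpl; ring).
    change (- ((- sin t)%R, cos t))%C with (- - sin t, - cos t) in Hpos.
    change (- (cos t, sin t))%C with (- cos t, - sin t) in Hpos.
    replace (cos t * 0 - sin t * 1) with (- sin t) by ring.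
    replace (sin t * 0 + cos t * 1) with (cos t) by ring. exact Hpos.
  - intros t _. repeat apply @continuous_plus; auto.
Qed.

(** The error, measured by [F], of the approximation of [h] by a multiple of [k]
    on the unit circle. Both parts of the functional of the mean value property
    are of this form, with [k] constant for the first one and [k] proportional
    to the conjugation for the second one. *)
Definition radial_energy (F : R -> R) (h k : C -> C) (a : C) : R :=
  RInt (fun t => F (Cmod (h (cos t, sin t) - a * k (cos t, sin t)))) 0 (2 * PI).

(** The data of a radial fitting problem on the unit circle: a bounded
    continuous target [h] and a continuous direction field [k] of constant
    nonzero modulus. *)
Record fitting_data (h k : C -> C) (M kappa : R) : Prop := {
  fitting_target_continuous : continuous_curve (fun t => h (cos t, sin t));
  fitting_direction_continuous : continuous_curve (fun t => k (cos t, sin t));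
  fitting_target_bound : forall u, Cmod u = 1 -> Cmod (h u) <= M;
  fitting_direction_Cmod : forall u, Cmod u = 1 -> Cmod (k u) = kappa;
  fitting_direction_pos : 0 < kappa }.

Lemma continuous_energy_integrand (F F' : R -> R) (h k : C -> C) (M kappa : R) (a : C) :
  weight F F' -> fitting_data h k M kappa ->
  forall t, continuous
    (fun x => F (Cmod (h (cos x, sin x) - a * k (cos x, sin x)))) t.
Proof.
  intros W D.
  apply (continuous_radial_curve F F' (fun x => h (cos x, sin x) - a * k (cos x, sin x))%C W).
  apply continuous_curve_minus; [apply D|]. apply continuous_curve_scale, D.
Qed.

Lemma radial_energy_strictly_convex (F F' : R -> R) (h k : C -> C) (M kappa : R) :
  weight F F' -> fitting_data h k M kappa -> strictly_convex_plane (radial_energy F h k).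
Proof.
  intros W D v w lam Hvw Hl.
  assert (Hc := fun a => continuous_energy_integrand F F' h k M kappa a W D).
  unfold radial_energy.
  rewrite RInt_lincomb by auto.
  apply RInt_lt; [generalize PI_RGT_0; lra| | |].
  - intros t _. apply @continuous_plus;
      (apply @continuous_mult; [apply continuous_const|auto]).
  - intros; auto.
  - intros t _. set (u := (cos t, sin t)).
    assert (Hu : Cmod (k u) = kappa) by apply D, Cmod_circle.
    replace (h u - (RtoC lam * v + RtoC (1 - lam) * w) * k u)%C
      with (RtoC lam * (h u - v * k u) + RtoC (1 - lam) * (h u - w * k u))%C
      by (apply C_eq; unfold Re, Im; simpl; ring).
    apply (radial_strictly_convex W); auto.
    intro E. apply Hvw.
    assert (Z : ((v - w) * k u)%C = 0).
    { replace ((v - w) * k u)%C with ((h u - w * k u) - (h u - v * k u))%C by ring.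
      rewrite E. ring. }
    assert (Z' : Cmod (v - w) * kappa = 0) by (rewrite <- Hu, <- Cmod_mult, Z; apply Cmod_0).
    generalize (fitting_direction_pos _ _ _ _ D). intros.
    assert (Z2 : Cmod (v - w) = 0) by nra.
    replace v with (v - w + w)%C by ring. rewrite (Cmod_eq_0 _ Z2). ring.
Qed.

Lemma radial_energy_lipschitz (F F' : R -> R) (h k : C -> C) (M kappa : R) :
  weight F F' -> fitting_data h k M kappa -> locally_lipschitz (radial_energy F h k).
Proof.
  intros W D K.
  assert (Hc := fun a => continuous_energy_integrand F F' h k M kappa a W D).
  assert (Hk := fitting_direction_pos _ _ _ _ D).
  pose (B := Rmax 0 (M + Rabs K * kappa)).
  assert (HB : 0 <= F' B) by (apply (weight_deriv_nonneg W), Rmax_l).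
  assert (HPI := PI_RGT_0).
  exists (2 * PI * (F' B * kappa)). split.
  { apply Rmult_le_pos; [lra|apply Rmult_le_pos; lra]. }
  intros v w Hv Hw. unfold radial_energy.
  rewrite <- (RInt_minus (V := R_CompleteNormedModule))
    by (apply ex_RInt_continuous_all; auto).
  replace (2 * PI * (F' B * kappa) * Cmod (v - w))
    with ((2 * PI - 0) * (F' B * (kappa * Cmod (v - w)))) by ring.
  apply abs_RInt_le_const; [lra| |].
  { apply @ex_RInt_minus; apply ex_RInt_continuous_all; auto. }
  intros t _. set (u := (cos t, sin t)).
  assert (Hu : Cmod (k u) = kappa) by apply D, Cmod_circle.
  assert (Hh : Cmod (h u) <= M) by apply D, Cmod_circle.
  assert (Hb : forall a, Cmod a <= K -> Cmod (h u - a * k u) <= B).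
  { intros a Ha. eapply Rle_trans; [apply Cmod_triangle|].
    rewrite Cmod_opp, Cmod_mult, Hu.
    eapply Rle_trans; [|apply Rmax_r]. apply Rplus_le_compat; auto.
    apply Rmult_le_compat_r; [lra|]. generalize (Rle_abs K). lra. }
  eapply Rle_trans; [apply (radial_lipschitz W B); auto|].
  right. f_equal. rewrite <- Hu, <- Cmod_mult, <- Cmod_opp.
  replace (- (h u - v * k u - (h u - w * k u)))%C with (k u * (v - w))%C by ring.
  reflexivity.
Qed.

(** Comparison of two energies by the subgradient inequality at
    [h v - a * k v], integrated over the circle. *)
Lemma radial_energy_lt (F F' : R -> R) (h k : C -> C) (M kappa : R) (a b : C) :
  weight F F' -> fitting_data h k M kappa ->
  (forall u, Cmod u = 1 ->
     let p v := dot (radial_grad F' (h v - a * k v)) ((b - a) * k v) in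
     p u + p (- u)%C + (p (Ci * u)%C + p (- (Ci * u))%C) < 0) ->
  radial_energy F h k a < radial_energy F h k b.
Proof.
  intros W D Hp.
  assert (Hc := fun a => continuous_energy_integrand F F' h k M kappa a W D).
  apply Rlt_0_minus. unfold radial_energy.
  rewrite <- (RInt_minus (V := R_CompleteNormedModule))
    by (apply ex_RInt_continuous_all; auto).
  apply (RInt_circle_pos (fun v => F (Cmod (h v - b * k v)) - F (Cmod (h v - a * k v)))).
  { intros t. apply @continuous_minus; auto. }
  intros u Hu. specialize (Hp u Hu). cbv zeta in Hp.
  assert (Hs : forall v, - dot (radial_grad F' (h v - a * k v)) ((b - a) * k v)
            <= F (Cmod (h v - b * k v)) - F (Cmod (h v - a * k v))).
  { intros v. generalize (radial_subgradient F F' (h v - a * k v) (h v - b * k v) W).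
    replace (h v - b * k v - (h v - a * k v))%C with (- ((b - a) * k v))%C by ring.
    assert (E : forall x y, dot x (- y)%C = - dot x y)
      by (intros; unfold dot, Re, Im; simpl; ring).
    rewrite E. lra. }
  generalize (Hs u) (Hs (- u)%C) (Hs (Ci * u)%C) (Hs (- (Ci * u))%C). lra.
Qed.

(** * Monotonicity of the gradient *)

(** Between [s] and [t], [F'] grows at least like the power [Lminus] and at most
    like the power [Lplus]. *)
Definition power_growth (F' : R -> R) (Lminus Lplus : R) : Prop :=
  forall s t, 0 < s <= t ->
    Lminus * (ln t - ln s) <= ln (F' t) - ln (F' s) <= Lplus * (ln t - ln s).

Lemma power_growth_intro (F' F'' : R -> R) (Lminus Lplus : R) :
  (forall s, 0 < s -> 0 < F' s) ->
  (forall s, 0 < s -> is_derive F' s (F'' s)) ->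
  (forall s, 0 < s -> Lminus <= Lambda F' F'' s <= Lplus) ->
  power_growth F' Lminus Lplus.
Proof.
  intros Hpos Hd HL s t [Hs Hst].
  assert (Hmono : forall L,
    exists x, s <= x <= t /\
      (ln (F' t) - L * ln t) - (ln (F' s) - L * ln s)
      = (Lambda F' F'' x - L) / x * (t - s)).
  { intros L.
    assert (Hder : forall x, 0 < x ->
       is_derive (fun x => ln (F' x) - L * ln x) x ((Lambda F' F'' x - L) / x)).
    { intros x Hx. assert (Hp := Hpos x Hx).
      replace ((Lambda F' F'' x - L) / x) with (F'' x * / F' x - L * / x)
        by (unfold Lambda; field; lra).
      apply (is_derive_minus (fun x => ln (F' x)) (fun x => L * ln x)).
      - apply (is_derive_comp ln F' x); [apply is_derive_ln|]; auto.
      - apply is_derive_scal, is_derive_ln; auto. }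
    destruct (MVT_gen (fun x => ln (F' x) - L * ln x) s t
                (fun x => (Lambda F' F'' x - L) / x)) as [x [Hx E]].
    - intros x. rewrite Rmin_left by lra. intros Hx. apply Hder. lra.
    - intros x. rewrite Rmin_left by lra. intros Hx.
      apply derivable_continuous_pt. eexists. apply is_derive_Reals, Hder. lra.
    - rewrite Rmin_left, Rmax_right in Hx by lra. exists x. split; auto. }
  split.
  - destruct (Hmono Lminus) as [x [Hx E]].
    assert (0 <= (Lambda F' F'' x - Lminus) / x * (t - s)); [|lra].
    generalize (HL x ltac:(lra)). intros. apply Rmult_le_pos; [|lra].
    apply Rdiv_le_0_compat; lra.
  - destruct (Hmono Lplus) as [x [Hx E]].
    assert (0 <= (Lplus - Lambda F' F'' x) / x * (t - s)).
    { generalize (HL x ltac:(lra)). intros. apply Rmult_le_pos; [|lra].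
      apply Rdiv_le_0_compat; lra. }
    replace ((Lambda F' F'' x - Lplus) / x) with (- ((Lplus - Lambda F' F'' x) / x)) in E
      by (field; lra). lra.
Qed.

Lemma ln_le_minus_1 (x : R) : 0 < x -> ln x <= x - 1.
Proof.
  intros Hx. generalize (exp_ineq1_le (ln x)). rewrite exp_ln; lra.
Qed.

Lemma exp_le_compat (x y : R) : x <= y -> exp x <= exp y.
Proof. intros [H| ->]; [apply Rlt_le, exp_increasing, H|apply Rle_refl]. Qed.

(** Polar form of the monotonicity of the gradient: a radial part and an
    angular part, both nonnegative. *)
Lemma radial_grad_polar (F F' : R -> R) (x y : C) : weight F F' ->
  dot (radial_grad F' x - radial_grad F' y) (x - y)
  = (F' (Cmod x) - F' (Cmod y)) * (Cmod x - Cmod y)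
    + (F' (Cmod x) / Cmod x + F' (Cmod y) / Cmod y) * (Cmod x * Cmod y - dot x y).
Proof.
  intros W.
  assert (K : forall v, F' (Cmod v) = F' (Cmod v) / Cmod v * Cmod v).
  { intros v. destruct (Req_dec (Cmod v) 0) as [Z|Z].
    - rewrite Z, (weight_deriv_0 _ _ W). ring.
    - field. exact Z. }
  replace (F' (Cmod x) - F' (Cmod y))
    with (F' (Cmod x) / Cmod x * Cmod x - F' (Cmod y) / Cmod y * Cmod y)
    by (rewrite <- !K; reflexivity).
  unfold radial_grad.
  replace (dot (RtoC (F' (Cmod x) / Cmod x) * x - RtoC (F' (Cmod y) / Cmod y) * y) (x - y))
    with (F' (Cmod x) / Cmod x * (Cmod x * Cmod x - dot x y)
          + F' (Cmod y) / Cmod y * (Cmod y * Cmod y - dot x y))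
    by (rewrite !Cmod_sqr; unfold dot, Re, Im; simpl; ring).
  ring.
Qed.

(** The bound is scale invariant: besides the growth exponents, the constant
    depends only on the ratio between the separation of the points and the
    radius of the disk. *)
Lemma radial_grad_uniform_monotone (F F' : R -> R) (Lminus Lplus sigma : R) :
  weight F F' -> 0 < Lminus -> power_growth F' Lminus Lplus -> 0 < sigma ->
  exists kappa, 0 < kappa /\
    forall M x y, 0 < M -> Cmod x <= M -> Cmod y <= M -> sigma * M <= Cmod (x - y) ->
      kappa * (M * F' M) <= dot (radial_grad F' x - radial_grad F' y) (x - y).
Proof.
  intros W HLm HG Hsig.
  pose (k1 := 1 - exp (- (Lminus * (sigma / 2)))).
  pose (k2 := exp (Lplus * ln (sigma / 2))).
  assert (Hk1 : 0 < k1).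
  { unfold k1. rewrite <- exp_0 at 1. apply Rlt_0_minus, exp_increasing.
    assert (0 < Lminus * (sigma / 2)) by (apply Rmult_lt_0_compat; lra). lra. }
  assert (Hk2 : 0 < k2) by apply exp_pos.
  assert (Hs2 : 0 < 3 / 8 * (sigma * sigma)) by nra.
  exists (k2 * Rmin (k1 * (sigma / 2)) (3 / 8 * (sigma * sigma))).
  assert (Hmin : 0 < Rmin (k1 * (sigma / 2)) (3 / 8 * (sigma * sigma)))
    by (apply Rmin_glb_lt; nra).
  split; [apply Rmult_lt_0_compat; auto|].
  assert (Main : forall M x y, 0 < M -> Cmod y <= Cmod x -> Cmod x <= M ->
      sigma * M <= Cmod (x - y) ->
      k2 * Rmin (k1 * (sigma / 2)) (3 / 8 * (sigma * sigma)) * (M * F' M)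
      <= dot (radial_grad F' x - radial_grad F' y) (x - y)).
  2:{ intros M x y HM Hx Hy Hxy. destruct (Rle_dec (Cmod y) (Cmod x)) as [H|H].
      - apply Main; auto.
      - replace (dot (radial_grad F' x - radial_grad F' y) (x - y))
          with (dot (radial_grad F' y - radial_grad F' x) (y - x))
          by (unfold dot, Re, Im; simpl; ring).
        apply Main; auto; [lra|]. rewrite Cmod_minus_sym. exact Hxy. }
  intros M x y HM Hyx Hx Hxy. rewrite (radial_grad_polar F F' x y W).
  assert (Htri : Cmod (x - y) <= Cmod x + Cmod y).
  { eapply Rle_trans; [apply Cmod_triangle|]. rewrite Cmod_opp. lra. }
  generalize (Cmod_ge_0 y) (dot_le_Cmod x y). intros Hy0 Hdot.
  assert (HsM : 0 < sigma * M) by nra.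
  assert (HX : sigma / 2 * M <= Cmod x) by lra.
  assert (Hd0 : 0 < sigma / 2 * M) by lra.
  assert (HFM := weight_deriv_pos _ _ W M HM).
  assert (Hsq : Cmod (x - y) * Cmod (x - y)
     = (Cmod x - Cmod y) * (Cmod x - Cmod y) + 2 * (Cmod x * Cmod y - dot x y)).
  { replace ((Cmod x - Cmod y) * (Cmod x - Cmod y))
      with (Cmod x * Cmod x + Cmod y * Cmod y - 2 * (Cmod x * Cmod y)) by ring.
    rewrite !Cmod_sqr. unfold dot, Re, Im; simpl; ring. }
  set (X := Cmod x) in *. set (Y := Cmod y) in *.
  (* doubling: [F' X] is comparable to [F' M] *)
  assert (HFX : k2 * F' M <= F' X).
  { destruct (HG (sigma / 2 * M) M ltac:(lra)) as [_ H].
    rewrite ln_mult in H by lra.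
    apply Rle_trans with (F' (sigma / 2 * M)).
    2: apply (weight_deriv_incr _ _ W); lra.
    assert (Hp := weight_deriv_pos _ _ W _ Hd0).
    rewrite <- (exp_ln (F' M)), <- (exp_ln (F' (sigma / 2 * M))) by auto.
    unfold k2. rewrite <- exp_plus. apply exp_le_compat. lra. }
  assert (HFXp : 0 < F' X) by (apply (weight_deriv_pos _ _ W); lra).
  assert (HFY : 0 <= F' Y) by (apply (weight_deriv_nonneg W); lra).
  assert (HFYX : F' Y <= F' X) by (apply (weight_deriv_incr _ _ W); lra).
  assert (Hang : 0 <= F' Y / Y).
  { unfold Rdiv. destruct (Req_dec Y 0) as [->|Z].
    - rewrite (weight_deriv_0 _ _ W). lra.
    - apply Rmult_le_pos; [lra|]. apply Rlt_le, Rinv_0_lt_compat. lra. }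
  assert (HXM : F' X / M <= F' X / X).
  { unfold Rdiv. apply Rmult_le_compat_l; [lra|]. apply Rinv_le_contravar; lra. }
  assert (HXM0 : 0 <= F' X / M) by (apply Rdiv_le_0_compat; lra).
  destruct (Rle_dec (sigma / 2 * M) (X - Y)) as [Hfar|Hnear].
  - (* radially separated points *)
    assert (Hrat : F' Y <= (1 - k1) * F' X).
    { destruct (Req_dec Y 0) as [Z|Z].
      - rewrite Z, (weight_deriv_0 _ _ W). unfold k1.
        generalize (exp_pos (- (Lminus * (sigma / 2)))). nra.
      - assert (HY : 0 < Y) by lra.
        destruct (HG Y X ltac:(lra)) as [H _].
        assert (Hln : sigma / 2 <= ln X - ln Y).
        { generalize (ln_le_minus_1 (Y / X) (Rdiv_lt_0_compat Y X HY ltac:(lra))).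
          rewrite ln_div by lra. intros Hl.
          assert (sigma / 2 <= (X - Y) / X).
          { apply Rmult_le_reg_r with X; [lra|]. unfold Rdiv at 2.
            rewrite Rmult_assoc, Rinv_l, Rmult_1_r by lra. nra. }
          replace ((X - Y) / X) with (1 - Y / X) in * by (field; lra). lra. }
        assert (Hp := weight_deriv_pos _ _ W _ HY).
        rewrite <- (exp_ln (F' Y)), <- (exp_ln (F' X)) by auto.
        unfold k1. replace (1 - (1 - exp (- (Lminus * (sigma / 2)))))
          with (exp (- (Lminus * (sigma / 2)))) by ring.
        rewrite <- exp_plus. apply exp_le_compat.
        assert (Lminus * (sigma / 2) <= Lminus * (ln X - ln Y))
          by (apply Rmult_le_compat_l; lra). lra. }
    assert (H2 : 0 <= (F' X / X + F' Y / Y) * (X * Y - dot x y))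
      by (apply Rmult_le_pos; lra).
    assert (H3 : k1 * (k2 * F' M) * (sigma / 2 * M) <= (F' X - F' Y) * (X - Y)).
    { apply Rmult_le_compat; try lra.
      - apply Rmult_le_pos; [lra|apply Rmult_le_pos; lra].
      - apply Rle_trans with (k1 * F' X); [apply Rmult_le_compat_l; lra|lra]. }
    assert (H4 : k2 * Rmin (k1 * (sigma / 2)) (3 / 8 * (sigma * sigma)) * (M * F' M)
                 <= k2 * (k1 * (sigma / 2)) * (M * F' M)).
    { apply Rmult_le_compat_r; [apply Rmult_le_pos; lra|].
      apply Rmult_le_compat_l; [lra|apply Rmin_l]. }
    lra.
  - (* angularly separated points *)
    assert (Ha : 3 / 8 * (sigma * sigma) * (M * M) <= X * Y - dot x y) by nra.
    assert (H2 : 0 <= (F' X - F' Y) * (X - Y)) by (apply Rmult_le_pos; lra).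
    assert (H3 : k2 * F' M / M * (3 / 8 * (sigma * sigma) * (M * M))
                 <= (F' X / X + F' Y / Y) * (X * Y - dot x y)).
    { apply Rmult_le_compat; try lra.
      - apply Rdiv_le_0_compat; [apply Rmult_le_pos; lra|lra].
      - nra.
      - apply Rle_trans with (F' X / M); [|lra]. unfold Rdiv.
        apply Rmult_le_compat_r; [|lra]. apply Rlt_le, Rinv_0_lt_compat. lra. }
    assert (H4 : k2 * Rmin (k1 * (sigma / 2)) (3 / 8 * (sigma * sigma)) * (M * F' M)
                 <= k2 * (3 / 8 * (sigma * sigma)) * (M * F' M)).
    { apply Rmult_le_compat_r; [apply Rmult_le_pos; lra|].
      apply Rmult_le_compat_l; [lra|apply Rmin_r]. }
    replace (k2 * F' M / M * (3 / 8 * (sigma * sigma) * (M * M)))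
      with (k2 * (3 / 8 * (sigma * sigma)) * (M * F' M)) in H3 by (field; lra).
    lra.
Qed.

(** * The constant part of the mean *)

Lemma radial_grad_opp (F' : R -> R) (w : C) :
  radial_grad F' (- w)%C = (- radial_grad F' w)%C.
Proof. unfold radial_grad. rewrite Cmod_opp. ring. Qed.

Lemma Cmod_opp_unit (u : C) : Cmod u = 1 -> Cmod (- u) = 1.
Proof. now rewrite Cmod_opp. Qed.

Lemma Cmod_Ci_unit (u : C) : Cmod u = 1 -> Cmod (Ci * u) = 1.
Proof. intros H. rewrite Cmod_mult, Cmod_Ci, H. ring. Qed.

(** Two opposite points of the circle together contribute
    [dot (H x - H y) d], where [H] is the gradient and [x - y] is close to
    [- 2 d] because the linear part of [h] is odd; monotonicity of [H] makes
    this negative. *)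
Lemma constant_fit_descent (F F' : R -> R) (Lminus Lplus M0 e : R) :
  weight F F' -> 0 < Lminus -> power_growth F' Lminus Lplus -> 0 <= M0 -> 0 < e ->
  exists eta, 0 < eta /\
    forall (r M : R) (h L : C -> C) (w0 : C), 0 < r ->
      fitting_data h (fun _ => RtoC 1) M 1 ->
      (forall u, L (- u)%C = (- L u)%C) ->
      (forall u, Cmod u = 1 -> Cmod (L u) <= M0) ->
      (forall u, Cmod u = 1 -> Cmod (h u - w0 - RtoC r * L u) <= eta * r) ->
      forall d, Cmod d = r * e ->
        radial_energy F h (fun _ => RtoC 1) (w0 + d)%C
        < radial_energy F h (fun _ => RtoC 1) (w0 + RtoC 2 * d)%C.
Proof.
  intros W HLm HG HM0 He.
  pose (m := M0 + 1 + e). assert (Hm : 0 < m) by (unfold m; lra).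
  destruct (radial_grad_uniform_monotone F F' Lminus Lplus (e / m) W HLm HG
              (Rdiv_lt_0_compat _ _ He Hm)) as [kappa [Hk Hmono]].
  (* [e / 2] keeps opposite points separated by [r e]; [kappa * m / 8] makes the
     defect of oddness smaller than the monotonicity bound *)
  pose (eta := Rmin 1 (Rmin (e / 2) (kappa * m / 8))).
  assert (Hkm : 0 < kappa * m) by (apply Rmult_lt_0_compat; auto).
  exists eta. split.
  { unfold eta. repeat apply Rmin_glb_lt; lra. }
  intros r M h L w0 Hr D HL HLM Hh d Hd.
  assert (Heta1 : eta <= 1) by apply Rmin_l.
  assert (Heta2 : eta <= e / 2)
    by (eapply Rle_trans; [apply Rmin_r|apply Rmin_l]).
  assert (Heta3 : eta <= kappa * m / 8)
    by (eapply Rle_trans; [apply Rmin_r|apply Rmin_r]).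
  assert (Hrm : 0 < r * m) by (apply Rmult_lt_0_compat; auto).
  assert (HF := weight_deriv_pos _ _ W _ Hrm).
  assert (Hpair : forall u, Cmod u = 1 ->
     dot (radial_grad F' (h u - (w0 + d) * RtoC 1)) d
     + dot (radial_grad F' (h (- u)%C - (w0 + d) * RtoC 1)) d < 0).
  { intros u Hu. assert (Hu' := Cmod_opp_unit u Hu).
    assert (Hb : forall v, Cmod v = 1 -> Cmod (h v - (w0 + d) * RtoC 1) <= r * m).
    { intros v Hv.
      replace (h v - (w0 + d) * RtoC 1)%C
        with ((h v - w0 - RtoC r * L v) + (RtoC r * L v + - d))%C by ring.
      generalize (Hh v Hv) (HLM v Hv)
        (Cmod_triangle (h v - w0 - RtoC r * L v) (RtoC r * L v + - d))
        (Cmod_triangle (RtoC r * L v) (- d)).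
      rewrite Cmod_opp, Cmod_real_mult, Hd by lra. unfold m. nra. }
    set (x := (h u - (w0 + d) * RtoC 1)%C).
    set (y := (- (h (- u)%C - (w0 + d) * RtoC 1))%C).
    assert (Hx : Cmod x <= r * m) by (apply Hb; auto).
    assert (Hy : Cmod y <= r * m) by (unfold y; rewrite Cmod_opp; apply Hb; auto).
    replace (h (- u)%C - (w0 + d) * RtoC 1)%C with (- y)%C by (unfold y; ring).
    rewrite radial_grad_opp, dot_opp_l.
    set (E := ((h u - w0 - RtoC r * L u)
               + (h (- u)%C - w0 - RtoC r * L (- u)%C))%C).
    assert (HE : Cmod E <= 2 * eta * r).
    { eapply Rle_trans; [apply Cmod_triangle|].
      generalize (Hh u Hu) (Hh _ Hu'). lra. }
    assert (Hxy : (x - y)%C = (E - RtoC 2 * d)%C).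
    { unfold x, y, E. rewrite HL. ring. }
    assert (Hsep : e / m * (r * m) <= Cmod (x - y)).
    { replace (e / m * (r * m)) with (r * e) by (field; lra).
      assert (H2 : Cmod (RtoC 2 * d) <= Cmod (x - y) + Cmod E).
      { replace (RtoC 2 * d)%C with (- (x - y) + E)%C by (rewrite Hxy; ring).
        eapply Rle_trans; [apply Cmod_triangle|]. rewrite Cmod_opp. lra. }
      rewrite Cmod_real_mult, Hd in H2 by lra. nra. }
    generalize (Hmono _ x y Hrm Hx Hy Hsep). rewrite Hxy.
    set (G := (radial_grad F' x - radial_grad F' y)%C).
    replace (dot G (E - RtoC 2 * d)) with (dot G E - 2 * dot G d)
      by (unfold dot, Re, Im; simpl; ring).
    replace (dot (radial_grad F' x) d + - dot (radial_grad F' y) d) with (dot G d)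
      by (unfold G, dot, Re, Im; simpl; ring).
    assert (HGm : Cmod G <= 2 * F' (r * m)).
    { unfold G. eapply Rle_trans; [apply Cmod_triangle|].
      rewrite Cmod_opp, !(radial_grad_Cmod F F') by auto.
      generalize (weight_deriv_incr _ _ W _ _ (conj (Cmod_ge_0 x) Hx))
        (weight_deriv_incr _ _ W _ _ (conj (Cmod_ge_0 y) Hy)). lra. }
    assert (HGE : dot G E <= 2 * F' (r * m) * (2 * eta * r)).
    { eapply Rle_trans; [apply dot_le_Cmod|].
      apply Rmult_le_compat; auto; apply Cmod_ge_0. }
    assert (Hfin : 2 * F' (r * m) * (2 * eta * r) <= kappa * (r * m * F' (r * m)) / 2).
    { assert (0 < r * F' (r * m)) by (apply Rmult_lt_0_compat; auto).
      assert (r * F' (r * m) * eta <= r * F' (r * m) * (kappa * m / 8))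
        by (apply Rmult_le_compat_l; lra). lra. }
    assert (0 < kappa * (r * m * F' (r * m))).
    { repeat apply Rmult_lt_0_compat; auto. }
    lra. }
  apply (radial_energy_lt F F' h _ M 1 _ _ W D).
  intros u Hu. cbv zeta.
  replace ((w0 + RtoC 2 * d - (w0 + d)) * RtoC 1)%C with d by ring.
  generalize (Hpair u Hu) (Hpair (Ci * u)%C (Cmod_Ci_unit u Hu)). lra.
Qed.

(** * The linear part of the mean *)

(** The derivative at [w0] of the gradient of [w |-> F |w|], where
    [c = w0 / conj w0], [P = (F'' + F'/s) / 2] and [Q = (F'' - F'/s) / 2] at
    [s = |w0|]. *)
Definition hessian (P Q : R) (c v : C) : C := (RtoC P * v + RtoC Q * c * Cconj v)%C.

Lemma hessian_Cmod (P Q : R) (c v : C) : Cmod c = 1 ->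
  Cmod (hessian P Q c v) <= (Rabs P + Rabs Q) * Cmod v.
Proof.
  intros Hc. eapply Rle_trans; [apply Cmod_triangle|].
  rewrite !Cmod_mult, !Cmod_R, Cmod_conj, Hc. lra.
Qed.

Lemma is_derive_bound (g : R -> R) (x l eps : R) : is_derive g x l -> 0 < eps ->
  exists del, 0 < del /\
    forall y, Rabs (y - x) < del -> Rabs (g y - g x - l * (y - x)) <= eps * Rabs (y - x).
Proof.
  intros [_ H] Heps.
  destruct (H x (fun P HP => HP) (mkposreal _ Heps)) as [del Hdel].
  exists del. split; [apply cond_pos|]. intros y Hy.
  generalize (Hdel y Hy).
  change (Rabs (g y - g x - (y - x) * l) <= eps * Rabs (y - x) ->
    Rabs (g y - g x - l * (y - x)) <= eps * Rabs (y - x)).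
  now rewrite (Rmult_comm (y - x) l).
Qed.

Lemma Cmod_first_order (w v : C) : w <> 0 ->
  Rabs (Cmod (w + v) - Cmod w - dot w v / Cmod w) <= 2 * (Cmod v * Cmod v) / Cmod w.
Proof.
  intros Hw. apply Cmod_gt_0 in Hw.
  generalize (Cmod_ge_0 (w + v)) (Cmod_ge_0 v). intros Hs Hv.
  assert (E : Cmod (w + v) * Cmod (w + v) = Cmod w * Cmod w + 2 * dot w v + Cmod v * Cmod v)
    by (rewrite !Cmod_sqr; unfold dot, Re, Im; simpl; ring).
  assert (Hd : Rabs (Cmod (w + v) - Cmod w) <= Cmod v).
  { generalize (Cmod_triangle_rev (w + v) w).
    replace (w + v - w)%C with v by ring. auto. }
  assert (Hdot : Rabs (dot w v) <= Cmod w * Cmod v).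
  { apply Rabs_le. split; [apply dot_ge_opp_Cmod|apply dot_le_Cmod]. }
  set (s := Cmod (w + v)) in *. set (s0 := Cmod w) in *.
  replace (s - s0 - dot w v / s0)
    with (((s0 - s) * dot w v + s0 * (Cmod v * Cmod v)) / (s0 * (s + s0))).
  2:{ replace (Cmod v * Cmod v) with (s * s - s0 * s0 - 2 * dot w v) by lra.
      field. lra. }
  unfold Rdiv at 1. rewrite Rabs_mult, (Rabs_right (/ _)).
  2: apply Rle_ge, Rlt_le, Rinv_0_lt_compat, Rmult_lt_0_compat; lra.
  assert (Hn : Rabs ((s0 - s) * dot w v + s0 * (Cmod v * Cmod v))
               <= 2 * (s0 * (Cmod v * Cmod v))).
  { eapply Rle_trans; [apply Rabs_triang|].
    rewrite Rabs_mult, (Rabs_right (s0 * _)) by (apply Rle_ge, Rmult_le_pos; nra).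
    rewrite (Rabs_minus_sym s0 s).
    assert (Rabs (s - s0) * Rabs (dot w v) <= Cmod v * (s0 * Cmod v))
      by (apply Rmult_le_compat; auto; apply Rabs_pos). lra. }
  apply Rle_trans with (2 * (s0 * (Cmod v * Cmod v)) * / (s0 * s0)).
  - apply Rmult_le_compat; auto.
    + apply Rabs_pos.
    + apply Rlt_le, Rinv_0_lt_compat, Rmult_lt_0_compat; lra.
    + apply Rinv_le_contravar; [apply Rmult_lt_0_compat; lra|].
      apply Rmult_le_compat_l; lra.
  - right. field. lra.
Qed.

Lemma radial_grad_expansion (F' : R -> R) (w0 : C) (l tau : R) :
  w0 <> 0 -> is_derive F' (Cmod w0) l -> 0 < tau ->
  let P := (l + F' (Cmod w0) / Cmod w0) / 2 in
  let Q := (l - F' (Cmod w0) / Cmod w0) / 2 in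
  exists rho, 0 < rho /\ forall v, Cmod v <= rho ->
    Cmod (radial_grad F' (w0 + v) - radial_grad F' w0
          - hessian P Q (w0 / Cconj w0) v) <= tau * Cmod v.
Proof.
  intros Hw Hl Htau P Q. assert (Hs0 := proj1 (Cmod_gt_0 w0) Hw).
  set (s0 := Cmod w0) in *.
  pose (phi := fun s => F' s / s).
  pose (l' := l / s0 - F' s0 / (s0 * s0)).
  assert (Hphi : is_derive phi s0 l').
  { unfold phi, l'. replace (l / s0 - F' s0 / (s0 * s0))
      with ((l * s0 - F' s0 * 1) / s0 ^ 2) by (field; lra).
    apply is_derive_div; [exact Hl|exact (@is_derive_id R_AbsRing s0)|lra]. }
  pose (tau1 := tau / (2 * s0)).
  assert (Htau1 : 0 < tau1) by (apply Rdiv_lt_0_compat; lra).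
  destruct (is_derive_bound phi s0 l' tau1 Hphi Htau1) as [del [Hdel Hexp]].
  pose (K := 3 * Rabs l' + tau1).
  assert (HK : 0 < K) by (unfold K; generalize (Rabs_pos l'); lra).
  exists (Rmin (del / 2) (tau / (2 * K))). split.
  { apply Rmin_glb_lt; [lra|]. apply Rdiv_lt_0_compat; lra. }
  intros v Hv.
  assert (Hv1 : Cmod v <= del / 2) by (eapply Rle_trans; [exact Hv|apply Rmin_l]).
  assert (Hv2 : Cmod v <= tau / (2 * K)) by (eapply Rle_trans; [exact Hv|apply Rmin_r]).
  assert (Hv0 := Cmod_ge_0 v).
  assert (Hd : Rabs (Cmod (w0 + v) - s0) <= Cmod v).
  { generalize (Cmod_triangle_rev (w0 + v) w0).
    replace (w0 + v - w0)%C with v by ring. auto. }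
  assert (Hfo := Cmod_first_order w0 v Hw). fold s0 in Hfo.
  specialize (Hexp (Cmod (w0 + v)) ltac:(lra)).
  set (s := Cmod (w0 + v)) in *.
  set (D := phi s - phi s0) in *.
  (* the increment of [radial_grad] is [D w0 + phi s0 v + D v], and the part of
     it that is linear in [v] is the hessian *)
  assert (E : (radial_grad F' (w0 + v) - radial_grad F' w0 - hessian P Q (w0 / Cconj w0) v)%C
              = (RtoC (D - l' * (dot w0 v / s0)) * w0 + RtoC D * v)%C).
  { assert (Hss : s0 * s0 = Re w0 * Re w0 + Im w0 * Im w0) by apply Cmod_sqr.
    assert (Hc : (w0 / Cconj w0 = RtoC (/ (s0 * s0)) * (w0 * w0))%C).
    { rewrite RtoC_inv by (apply Rgt_not_eq, Rmult_lt_0_compat; auto).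
      replace (RtoC (s0 * s0)) with (w0 * Cconj w0)%C
        by (rewrite Hss; apply C_eq; unfold Re, Im; simpl; ring).
      field. split; [|exact Hw]. intro Z. apply Hw.
      rewrite <- (Cconj_conj w0), Z. apply C_eq; unfold Re, Im; simpl; ring. }
    (* the rank-one part of the derivative, split along [v] and [conj v] *)
    assert (Hdot : (RtoC (dot w0 v) * w0
                    = RtoC (1 / 2) * (w0 * w0 * Cconj v + RtoC (s0 * s0) * v))%C).
    { rewrite Hss. apply C_eq; unfold dot, Re, Im; simpl; field. }
    replace (RtoC (D - l' * (dot w0 v / s0)) * w0)%C
      with (RtoC D * w0 - RtoC (l' / s0) * (RtoC (dot w0 v) * w0))%C
      by (apply C_eq; unfold Re, Im; simpl; field; lra).
    rewrite Hdot. unfold hessian. rewrite Hc.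
    replace (RtoC Q * (RtoC (/ (s0 * s0)) * (w0 * w0)) * Cconj v)%C
      with (RtoC Q * RtoC (/ (s0 * s0)) * (w0 * w0 * Cconj v))%C by ring.
    unfold radial_grad. fold s s0. change (F' s / s) with (phi s).
    change (F' s0 / s0) with (phi s0). unfold D.
    generalize (w0 * w0 * Cconj v)%C (phi s). intros y p.
    unfold P, Q, l', phi. apply C_eq; unfold Re, Im; simpl; field; lra. }
  rewrite E. eapply Rle_trans; [apply Cmod_triangle|].
  rewrite !Cmod_mult, !Cmod_R. fold s0.
  assert (HD : Rabs D <= (Rabs l' + tau1) * Cmod v).
  { replace D with ((D - l' * (s - s0)) + l' * (s - s0)) by ring.
    eapply Rle_trans; [apply Rabs_triang|]. rewrite Rabs_mult.
    generalize (Rabs_pos l'). intros. nra. }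
  assert (HD2 : Rabs (D - l' * (dot w0 v / s0))
                <= tau1 * Cmod v + Rabs l' * (2 * (Cmod v * Cmod v) / s0)).
  { replace (D - l' * (dot w0 v / s0))
      with ((D - l' * (s - s0)) + l' * (s - s0 - dot w0 v / s0)) by ring.
    eapply Rle_trans; [apply Rabs_triang|]. rewrite Rabs_mult.
    apply Rplus_le_compat.
    - eapply Rle_trans; [exact Hexp|]. apply Rmult_le_compat_l; lra.
    - apply Rmult_le_compat_l; [apply Rabs_pos|exact Hfo]. }
  assert (H1 : Rabs (D - l' * (dot w0 v / s0)) * s0
               <= tau / 2 * Cmod v + 2 * Rabs l' * (Cmod v * Cmod v)).
  { eapply Rle_trans; [apply Rmult_le_compat_r; [lra|exact HD2]|].
    right. unfold tau1. field. lra. }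
  assert (H2 : Rabs D * Cmod v <= (Rabs l' + tau1) * (Cmod v * Cmod v)).
  { rewrite <- Rmult_assoc. apply Rmult_le_compat_r; auto. }
  assert (H3 : K * (Cmod v * Cmod v) <= tau / 2 * Cmod v).
  { rewrite <- Rmult_assoc. apply Rmult_le_compat_r; auto.
    apply Rle_trans with (K * (tau / (2 * K))); [apply Rmult_le_compat_l; lra|].
    right. field. lra. }
  unfold K in H3. lra.
Qed.

Lemma Cmod_div_conj (w : C) : w <> 0 -> Cmod (w / Cconj w) = 1.
Proof.
  intros Hw. assert (H := proj1 (Cmod_gt_0 w) Hw).
  rewrite Cmod_div, Cmod_conj; [field; lra|].
  apply Cmod_gt_0. rewrite Cmod_conj. exact H.
Qed.

(** With [v = A u + B1 conj u], the average over quarter turns kills the terms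
    in [u^2]; only the interaction of the [conj u] modes is left. *)
Lemma hessian_quarter_sum (P Q : R) (c A B1 d u : C) : Cmod u = 1 ->
  let S v := dot (hessian P Q c (A * v + B1 * Cconj v)) (d * Cconj v) in
  S u + S (- u)%C + (S (Ci * u)%C + S (- (Ci * u))%C)
  = 4 * dot (RtoC P * B1 + RtoC Q * c * Cconj A) d.
Proof.
  intros Hu S.
  assert (E : Re u * Re u + Im u * Im u = 1) by (rewrite <- Cmod_sqr, Hu; ring).
  rewrite <- (Rmult_1_l (4 * _)), <- E.
  unfold S, hessian, dot, Re, Im; simpl; ring.
Qed.

Lemma dot_quarter_sum (g d u : C) :
  let S v := dot g (d * Cconj v) in
  S u + S (- u)%C + (S (Ci * u)%C + S (- (Ci * u))%C) = 0.
Proof. unfold dot, Re, Im; simpl; ring. Qed.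

(** Replacing the gradient by its first-order expansion at [w0] leaves, after
    the average over quarter turns, the negative term [- 4 r^2 P |d|^2] and an
    error that is smaller once [eta] and [r] are small. *)
Lemma linear_fit_descent (F F' : R -> R) (w0 A B : C) (l e : R) :
  weight F F' -> w0 <> 0 -> is_derive F' (Cmod w0) l -> 0 < e ->
  let P := (l + F' (Cmod w0) / Cmod w0) / 2 in
  let Q := (l - F' (Cmod w0) / Cmod w0) / 2 in
  let g0 := (B + RtoC (Q / P) * (w0 / Cconj w0) * Cconj A)%C in
  0 < P ->
  exists eta r0, 0 < eta /\ 0 < r0 /\
    forall (r M : R) (h : C -> C), 0 < r < r0 ->
      fitting_data h (fun u => RtoC r * Cconj u)%C M r ->
      (forall u, Cmod u = 1 ->
         Cmod (h u - w0 - RtoC r * (A * u + B * Cconj u)) <= eta * r) ->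
      forall d, Cmod d = e ->
        radial_energy F h (fun u => RtoC r * Cconj u)%C (g0 + d)%C
        < radial_energy F h (fun u => RtoC r * Cconj u)%C (g0 + RtoC 2 * d)%C.
Proof.
  intros W Hw Hl He P Q g0 HP.
  pose (c := (w0 / Cconj w0)%C).
  assert (Hc : Cmod c = 1) by apply (Cmod_div_conj w0 Hw).
  pose (m := Cmod A + Cmod (B - g0) + e + 1).
  assert (Hm : 0 < m).
  { unfold m. generalize (Cmod_ge_0 A) (Cmod_ge_0 (B - g0)). lra. }
  pose (N := Rabs P + Rabs Q).
  assert (HN : 0 < N).
  { unfold N. rewrite (Rabs_right P) by lra. generalize (Rabs_pos Q). lra. }
  assert (HPe : 0 < P * e) by (apply Rmult_lt_0_compat; auto).
  assert (Htau : 0 < P * e / (4 * m)) by (apply Rdiv_lt_0_compat; lra).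
  destruct (radial_grad_expansion F' w0 l _ Hw Hl Htau) as [rho [Hrho Hexp]].
  fold P Q c in Hexp.
  pose (eta := Rmin 1 (P * e / (4 * N))).
  assert (Heta1 : eta <= 1) by apply Rmin_l.
  assert (Heta2 : N * eta <= P * e / 4).
  { apply Rle_trans with (N * (P * e / (4 * N))).
    - apply Rmult_le_compat_l; [lra|apply Rmin_r].
    - right. field. lra. }
  exists eta, (rho / m). split; [|split].
  { apply Rmin_glb_lt; [lra|apply Rdiv_lt_0_compat; lra]. }
  { apply Rdiv_lt_0_compat; lra. }
  intros r M h [Hr Hr0] D Hh d Hd.
  assert (Hrm : r * m <= rho).
  { apply Rle_trans with (rho / m * m); [apply Rmult_le_compat_r; lra|].
    right. field. lra. }
  apply (radial_energy_lt F F' h _ M r _ _ W D).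
  intros u Hu. cbv zeta.
  replace (g0 + RtoC 2 * d - (g0 + d))%C with d by ring.
  pose (S1 := fun v => dot (radial_grad F' w0) (d * Cconj v)).
  pose (S2 := fun v => dot (hessian P Q c (A * v + (B - g0 - d) * Cconj v)) (d * Cconj v)).
  assert (Hpt : forall v, Cmod v = 1 ->
     dot (radial_grad F' (h v - (g0 + d) * (RtoC r * Cconj v))) (d * (RtoC r * Cconj v))
     <= r * S1 v + r * r * S2 v + r * r * (P * e * e / 2)).
  { intros v Hv.
    assert (Hdv : Cmod (d * Cconj v) = e)
      by (rewrite Cmod_mult, Cmod_conj, Hv, Hd; ring).
    set (x := (h v - (g0 + d) * (RtoC r * Cconj v) - w0)%C).
    replace (h v - (g0 + d) * (RtoC r * Cconj v))%C with (w0 + x)%C by (unfold x; ring).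
    set (lin := (A * v + (B - g0 - d) * Cconj v)%C) in *.
    set (err := (h v - w0 - RtoC r * (A * v + B * Cconj v))%C).
    assert (Herr : Cmod err <= eta * r) by (apply Hh; auto).
    assert (Hx : x = (err + RtoC r * lin)%C) by (unfold x, err, lin; ring).
    assert (Hlin : Cmod lin <= m - 1).
    { unfold lin, m. eapply Rle_trans; [apply Cmod_triangle|].
      rewrite !Cmod_mult, Cmod_conj, Hv.
      generalize (Cmod_triangle (B - g0) (- d)). rewrite Cmod_opp, Hd.
      change (B - g0 + - d)%C with (B - g0 - d)%C. lra. }
    assert (Hxm : Cmod x <= r * m).
    { rewrite Hx. eapply Rle_trans; [apply Cmod_triangle|].
      rewrite Cmod_real_mult by lra. nra. }
    assert (Hrem := Hexp x ltac:(lra)).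
    set (rem := (radial_grad F' (w0 + x) - radial_grad F' w0 - hessian P Q c x)%C) in *.
    assert (Hremb : Cmod rem <= r * (P * e) / 4).
    { eapply Rle_trans; [exact Hrem|].
      apply Rle_trans with (P * e / (4 * m) * (r * m)); [apply Rmult_le_compat_l; lra|].
      right. field. lra. }
    assert (Hsplit : dot (radial_grad F' (w0 + x)) (d * (RtoC r * Cconj v))
       = r * S1 v + r * r * S2 v
         + r * (dot (hessian P Q c err) (d * Cconj v) + dot rem (d * Cconj v))).
    { replace (radial_grad F' (w0 + x))
        with (radial_grad F' w0 + RtoC r * hessian P Q c lin + hessian P Q c err + rem)%C.
      - unfold S1, S2. fold lin. generalize (hessian P Q c lin) (hessian P Q c err).
        intros; unfold dot, Re, Im; simpl; ring.
      - unfold rem. rewrite Hx. unfold hessian.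
        apply C_eq; unfold Re, Im; simpl; ring. }
    rewrite Hsplit.
    assert (H1 : dot (hessian P Q c err) (d * Cconj v) <= r * (P * e) / 4 * e).
    { eapply Rle_trans; [apply dot_le_Cmod|]. rewrite Hdv.
      apply Rmult_le_compat_r; [lra|].
      eapply Rle_trans; [apply (hessian_Cmod P Q c err Hc)|]. fold N.
      apply Rle_trans with (N * (eta * r)); [apply Rmult_le_compat_l; lra|].
      rewrite <- Rmult_assoc. nra. }
    assert (H2 : dot rem (d * Cconj v) <= r * (P * e) / 4 * e).
    { eapply Rle_trans; [apply dot_le_Cmod|]. rewrite Hdv.
      apply Rmult_le_compat_r; lra. }
    assert (H3 : r * (dot (hessian P Q c err) (d * Cconj v) + dot rem (d * Cconj v))
                 <= r * (r * (P * e) / 4 * e + r * (P * e) / 4 * e))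
      by (apply Rmult_le_compat_l; lra).
    lra. }
  assert (Hs1 : S1 u + S1 (- u)%C + (S1 (Ci * u)%C + S1 (- (Ci * u))%C) = 0)
    by exact (dot_quarter_sum (radial_grad F' w0) d u).
  assert (Hs2 : S2 u + S2 (- u)%C + (S2 (Ci * u)%C + S2 (- (Ci * u))%C)
                = 4 * dot (RtoC P * (B - g0 - d) + RtoC Q * c * Cconj A) d)
    by exact (hessian_quarter_sum P Q c A (B - g0 - d) d u Hu).
  (* the choice of [g0] makes the [conj u] mode proportional to [d] *)
  replace (RtoC P * (B - g0 - d) + RtoC Q * c * Cconj A)%C with (- (RtoC P * d))%C in Hs2.
  2:{ unfold g0. fold c. replace (RtoC Q) with (RtoC P * RtoC (Q / P))%C; [ring|].
      rewrite <- RtoC_mult. f_equal. field. lra. }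
  assert (Hdd : dot (- (RtoC P * d)) d = - (P * (e * e)))
    by (rewrite <- Hd, Cmod_sqr; unfold dot, Re, Im; simpl; ring).
  rewrite Hdd in Hs2.
  generalize (Hpt u Hu) (Hpt (- u)%C (Cmod_opp_unit u Hu))
    (Hpt (Ci * u)%C (Cmod_Ci_unit u Hu))
    (Hpt (- (Ci * u))%C (Cmod_opp_unit _ (Cmod_Ci_unit u Hu))).
  intros K1 K2 K3 K4.
  assert (K5 : r * (S1 u + S1 (- u)%C + (S1 (Ci * u)%C + S1 (- (Ci * u))%C)) = 0)
    by (rewrite Hs1; ring).
  assert (K6 : r * r * (S2 u + S2 (- u)%C + (S2 (Ci * u)%C + S2 (- (Ci * u))%C))
               = r * r * (4 * - (P * (e * e)))) by (rewrite Hs2; ring).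
  assert (K7 : 0 < r * r * (P * (e * e))).
  { apply Rmult_lt_0_compat; [apply Rmult_lt_0_compat; auto|].
    rewrite <- Rmult_assoc. apply Rmult_lt_0_compat; auto. }
  lra.
Qed.

(** * First-order expansions of maps of the plane *)

(** [A] and [B] are the values at [z] of the derivatives in [z] and [conj z]. *)
Definition real_expansion (f : C -> C) (z A B : C) : Prop :=
  forall eps, 0 < eps -> exists del, 0 < del /\
    forall h, Cmod h < del -> Cmod (f (z + h)%C - f z - (A * h + B * Cconj h)) <= eps * Cmod h.

Lemma C_R_norm (v : C) : @norm R_AbsRing C_R_NormedModule v = Cmod v.
Proof.
  change (sqrt (Rabs (fst v) ^ 2 + Rabs (snd v) ^ 2) = Cmod v).
  unfold Cmod. rewrite !pow2_abs. reflexivity.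
Qed.

Lemma im_le_Cmod (v : C) : Rabs (Im v) <= Cmod v.
Proof.
  eapply Rle_trans; [|apply Rmax_Cmod]. apply (Rmax_r (Rabs (fst v))).
Qed.

Lemma locally_disk (z : C) (D : C -> Prop) : locally z D ->
  exists del, 0 < del /\ forall h, Cmod h < del -> D (z + h)%C.
Proof.
  intros [del Hdel]. exists del. split; [apply cond_pos|]. intros h Hh. apply Hdel.
  split.
  - change (Rabs (fst z + fst h - fst z) < del).
    replace (fst z + fst h - fst z) with (fst h) by ring.
    eapply Rle_lt_trans; [apply (re_le_Cmod h)|exact Hh].
  - change (Rabs (snd z + snd h - snd z) < del).
    replace (snd z + snd h - snd z) with (snd h) by ring.
    eapply Rle_lt_trans; [apply (im_le_Cmod h)|exact Hh].
Qed.

Lemma real_differentiable_expansion (f : C -> C) (z : C) :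
  real_differentiable f z -> exists A B, real_expansion f z A B.
Proof.
  intros [l [Hl Hd]].
  pose (p := (l (RtoC 1) : C)). pose (q := (l Ci : C)).
  exists ((p - Ci * q) / RtoC 2)%C, ((p + Ci * q) / RtoC 2)%C.
  assert (El : forall h : C, (l h : C)
     = ((p - Ci * q) / RtoC 2 * h + (p + Ci * q) / RtoC 2 * Cconj h)%C).
  { intros h.
    assert (Eh : h = @plus C_R_NormedModule (@scal R_AbsRing C_R_NormedModule (Re h) (RtoC 1))
                    (@scal R_AbsRing C_R_NormedModule (Im h) Ci)).
    { apply C_eq; unfold Re, Im.
      - change (fst h = fst h * 1 + snd h * 0). ring.
      - change (snd h = fst h * 0 + snd h * 1). ring. }
    rewrite Eh at 1. rewrite (linear_plus l Hl), !(linear_scal l Hl).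
    fold p q. apply C_eq; unfold Re, Im.
    - change (fst h * fst p + snd h * fst q
        = fst ((p - Ci * q) / RtoC 2 * h + (p + Ci * q) / RtoC 2 * Cconj h)%C).
      simpl. field.
    - change (fst h * snd p + snd h * snd q
        = snd ((p - Ci * q) / RtoC 2 * h + (p + Ci * q) / RtoC 2 * Cconj h)%C).
      simpl. field. }
  intros eps Heps.
  destruct (locally_disk z _ (Hd z (fun P HP => HP) (mkposreal _ Heps))) as [del [Hdel H]].
  exists del. split; [exact Hdel|]. intros h Hh. specialize (H h Hh). simpl in H.
  rewrite !C_R_norm in H.
  change (Cmod (f (z + h)%C - f z - (l (z + h - z)%C : C)) <= eps * Cmod (z + h - z)) in H.
  replace (z + h - z)%C with h in H by ring. rewrite El in H. exact H.
Qed.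

Lemma is_derive_intro (g : R -> R) (x l : R) :
  (forall eps, 0 < eps -> exists del, 0 < del /\
     forall h, Rabs h < del -> Rabs (g (x + h) - g x - l * h) <= eps * Rabs h) ->
  is_derive g x l.
Proof.
  intros H. split; [apply is_linear_scal_l|].
  intros y Hy.
  assert (E := @is_filter_lim_locally_unique R_AbsRing (AbsRing_NormedModule R_AbsRing) x y Hy).
  subst y. intros eps.
  destruct (H eps (cond_pos eps)) as [del [Hdel Hb]].
  exists (mkposreal _ Hdel). intros y Hyx.
  change (Rabs (g y - g x - (y - x) * l) <= eps * Rabs (y - x)).
  specialize (Hb (y - x) Hyx). rewrite Rplus_minus in Hb.
  now rewrite (Rmult_comm (y - x) l).
Qed.

(** Restriction of a first-order expansion to the line through [z] directed by
    the unit vector [d], read through a real coordinate [pr]. *)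
Lemma Derive_expansion (f : C -> C) (z A B d : C) (pr : C -> R) (g : R -> R) (x : R) :
  (forall v w, pr (v - w)%C = pr v - pr w) ->
  (forall v, Rabs (pr v) <= Cmod v) ->
  (forall s v, pr (RtoC s * v)%C = s * pr v) ->
  Cmod d = 1 ->
  (forall s, g (x + s) = pr (f (z + RtoC s * d)%C)) ->
  real_expansion f z A B ->
  Derive g x = pr (A * d + B * Cconj d)%C.
Proof.
  intros Hsub Hle Hsc Hd Hg HE. apply is_derive_unique, is_derive_intro.
  intros eps Heps. destruct (HE eps Heps) as [del [Hdel H]].
  exists del. split; [exact Hdel|]. intros s Hs.
  assert (Hm : Cmod (RtoC s * d) = Rabs s) by (rewrite Cmod_mult, Cmod_R, Hd; ring).
  specialize (H (RtoC s * d)%C ltac:(lra)). rewrite Hm in H.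
  eapply Rle_trans; [|exact H]. eapply Rle_trans; [|apply Hle]. right. f_equal.
  assert (Hg0 : g x = pr (f z)).
  { replace x with (x + 0) by ring. rewrite Hg.
    replace (z + RtoC 0 * d)%C with z by ring. reflexivity. }
  rewrite Hg, Hg0, !Hsub.
  replace (A * (RtoC s * d) + B * Cconj (RtoC s * d))%C
    with (RtoC s * (A * d + B * Cconj d))%C
    by (apply C_eq; unfold Re, Im; simpl; ring).
  rewrite Hsc. ring.
Qed.

Lemma d_zbar_expansion (f : C -> C) (z A B : C) :
  real_expansion f z A B -> d_zbar f z = B.
Proof.
  intros HE.
  assert (Hre : forall d g x, Cmod d = 1 ->
    (forall s, g (x + s) = Re (f (z + RtoC s * d)%C)) ->
    Derive g x = Re (A * d + B * Cconj d)%C).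
  { intros d g x Hd Hg. apply (Derive_expansion f z A B d Re g x); auto.
    - apply re_le_Cmod.
    - intros; unfold Re, Im; simpl; ring. }
  assert (Him : forall d g x, Cmod d = 1 ->
    (forall s, g (x + s) = Im (f (z + RtoC s * d)%C)) ->
    Derive g x = Im (A * d + B * Cconj d)%C).
  { intros d g x Hd Hg. apply (Derive_expansion f z A B d Im g x); auto.
    - apply im_le_Cmod.
    - intros; unfold Re, Im; simpl; ring. }
  assert (Hx : partial_x f z = (A + B)%C).
  { assert (Hs : forall s, (Re z + s, Im z) = (z + RtoC s * RtoC 1)%C)
      by (intros; apply C_eq; unfold Re, Im; simpl; ring).
    unfold partial_x.
    rewrite (Hre (RtoC 1)), (Him (RtoC 1)); try apply Cmod_1;
      try (intros; rewrite Hs; reflexivity).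
    apply C_eq; unfold Re, Im; simpl; ring. }
  assert (Hy : partial_y f z = (Ci * (A - B))%C).
  { assert (Hs : forall s, (Re z, Im z + s) = (z + RtoC s * Ci)%C)
      by (intros; apply C_eq; unfold Re, Im; simpl; ring).
    unfold partial_y.
    rewrite (Hre Ci), (Him Ci); try apply Cmod_Ci;
      try (intros; rewrite Hs; reflexivity).
    apply C_eq; unfold Re, Im; simpl; ring. }
  unfold d_zbar. rewrite Hx, Hy. apply C_eq; unfold Re, Im; simpl; field.
Qed.

Lemma real_expansion_conj (f : C -> C) (z A B : C) :
  real_expansion f z A B ->
  real_expansion (fun w => Cconj (f w)) z (Cconj B) (Cconj A).
Proof.
  intros HE eps Heps. destruct (HE eps Heps) as [del [Hdel H]].
  exists del. split; [exact Hdel|]. intros h Hh.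
  eapply Rle_trans; [|apply (H h Hh)]. right. rewrite <- Cmod_conj. f_equal.
  apply C_eq; unfold Re, Im; simpl; ring.
Qed.

(** * The asymptotic expansion of the mean *)

Lemma circle_fitting_data (Omega : C -> Prop) (f : C -> C) (z : C) (r M : R) :
  (forall w, Omega w -> real_differentiable f w) -> 0 < r ->
  (forall u, Cmod u = 1 -> Omega (z + RtoC r * u)%C) ->
  (forall u, Cmod u = 1 -> Cmod (f (z + RtoC r * u)%C) <= M) ->
  fitting_data (fun u => f (z + RtoC r * u)%C) (fun _ => RtoC 1) M 1 /\
  fitting_data (fun u => f (z + RtoC r * u)%C) (fun u => RtoC r * Cconj u)%C M r.
Proof.
  intros Hf Hr HO HM.
  assert (Hcont : continuous_curve (fun t => f (z + RtoC r * (cos t, sin t))%C)).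
  { intros t.
    pose (c := (fun x => (z + RtoC r * (cos x, sin x))%C) : R -> C).
    assert (Hft : continuous (f : C_R_NormedModule -> C_R_NormedModule) (c t)).
    { apply filterdiff_continuous, Hf, HO, Cmod_circle. }
    assert (Hct : filterlim (c : R -> C_R_NormedModule) (locally t) (locally (c t))).
    { apply filterlim_locally. intros eps.
      assert (H1 : continuous (fun x => fst z + (r * cos x - 0 * sin x)) t).
      { apply @continuous_plus; [apply continuous_const|].
        apply @continuous_minus; apply @continuous_mult;
          try apply continuous_const; [apply continuous_cos|apply continuous_sin]. }
      assert (H2 : continuous (fun x => snd z + (r * sin x + 0 * cos x)) t).
      { apply @continuous_plus; [apply continuous_const|].
        apply @continuous_plus; apply @continuous_mult;
          try apply continuous_const; [apply continuous_sin|apply continuous_cos]. }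
      generalize (filter_and _ _ (proj1 (filterlim_locally _ _) H1 eps)
                    (proj1 (filterlim_locally _ _) H2 eps)).
      apply filter_imp. intros x [Hx1 Hx2]. split; [exact Hx1|exact Hx2]. }
    assert (Hcomp : filterlim (fun x => f (c x) : C_R_NormedModule)
                      (locally t) (locally (f (c t) : C_R_NormedModule)))
      by (apply (filterlim_comp _ _ _ c f _ _ _ Hct Hft)).
    split.
    - apply (filterlim_comp _ _ _ (fun x => f (c x)) fst _ _ _ Hcomp).
      apply (@continuous_fst R_UniformSpace R_UniformSpace).
    - apply (filterlim_comp _ _ _ (fun x => f (c x)) snd _ _ _ Hcomp).
      apply (@continuous_snd R_UniformSpace R_UniformSpace). }
  split; split; auto.
  - intros t. split; apply continuous_const.
  - intros; apply Cmod_1.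
  - lra.
  - apply continuous_curve_scale. intros t. split.
    + apply continuous_cos.
    + apply (continuous_opp (V := R_NormedModule)), continuous_sin.
  - intros u Hu. rewrite Cmod_real_mult, Cmod_conj, Hu; lra.
Qed.

Lemma Gfun_split (F F' : R -> R) (f : C -> C) (r M : R) (z a b : C) :
  weight F F' ->
  let h := fun u => f (z + RtoC r * u)%C in
  fitting_data h (fun _ => RtoC 1) M 1 ->
  fitting_data h (fun u => RtoC r * Cconj u)%C M r ->
  Gfun F f r z (a, b)
  = r * radial_energy F h (fun _ => RtoC 1) a
    + r * radial_energy F h (fun u => RtoC r * Cconj u)%C b.
Proof.
  intros W h D1 D2. unfold radial_energy.
  rewrite RInt_lincomb.
  2: apply (continuous_energy_integrand F F' h _ M 1 a W D1).
  2: apply (continuous_energy_integrand F F' h _ M r b W D2).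
  unfold Gfun, circle_integral. simpl fst. simpl snd.
  apply RInt_ext. intros t _. unfold h.
  set (u := (cos t, sin t)).
  replace (z + RtoC r * u - z)%C with (RtoC r * u)%C by ring.
  replace (Cconj (RtoC r * u))%C with (RtoC r * Cconj u)%C
    by (apply C_eq; unfold Re, Im; simpl; ring).
  replace (a * RtoC 1)%C with a by ring.
  match goal with |- @eq _ ?x ?y => change (@eq R x y) end. ring.
Qed.

Lemma argminG_eq (F : R -> R) (f : C -> C) (r : R) (z m1 m2 : C) (J1 J2 : C -> R) :
  0 < r -> (forall a b, Gfun F f r z (a, b) = r * J1 a + r * J2 b) ->
  unique (is_min_point J1) m1 -> unique (is_min_point J2) m2 ->
  argminG F f r z = (m1, m2).
Proof.
  intros Hr HG [H1 U1] [H2 U2].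
  assert (U : unique (is_min_point (Gfun F f r z)) (m1, m2)).
  { split.
    - intros [a b]. rewrite !HG. specialize (H1 a). specialize (H2 b). nra.
    - intros [a b] Hab. f_equal.
      + apply U1. intros a'. specialize (Hab (a', b)). rewrite !HG in Hab. nra.
      + apply U2. intros b'. specialize (Hab (a, b')). rewrite !HG in Hab. nra. }
  assert (Ue := epsilon_spec (inhabits (RtoC 0, RtoC 0)) _ (ex_intro _ _ U)).
  fold (argminG F f r z) in Ue. symmetry. apply U. apply Ue.
Qed.

(** The left-hand side of the equation at [z]. *)
Definition residual (F' F'' : R -> R) (f : C -> C) (z : C) : C :=
  (d_zbar f z
   + RtoC ((Lambda F' F'' (Cmod (f z)) - 1) / (Lambda F' F'' (Cmod (f z)) + 1))
     * (f z / Cconj (f z)) * d_zbar (fun w => Cconj (f w)) z)%C.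

(** The mean satisfies [mu (f, r) (z) = f z + r * residual + o (r)] as [r] tends
    to [0] from the right. *)
Lemma mean_value_expansion (F F' F'' : R -> R) (Lminus Lplus : R)
  (Omega : C -> Prop) (f : C -> C) (z : C) (eps : R) :
  weight F F' -> 0 < Lminus ->
  (forall s, 0 < s -> is_derive F' s (F'' s)) ->
  (forall s, 0 < s -> Lminus <= Lambda F' F'' s <= Lplus) ->
  open Omega -> (forall w, Omega w -> real_differentiable f w) ->
  Omega z -> f z <> 0 -> 0 < eps ->
  at_right 0 (fun r =>
    Cmod (muG F f r z - f z - RtoC r * residual F' F'' f z) <= eps * r).
Proof.
  intros W HLm Hder HL Hopen Hf Hz Hfz Heps.
  assert (HG : power_growth F' Lminus Lplus)
    by (apply (power_growth_intro F' F''); auto; apply W).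
  destruct (real_differentiable_expansion f z (Hf z Hz)) as [A [B HE]].
  assert (Hs := proj1 (Cmod_gt_0 (f z)) Hfz).
  set (s := Cmod (f z)) in *.
  assert (HFs := weight_deriv_pos _ _ W s Hs).
  pose (P := (F'' s + F' s / s) / 2). pose (Q := (F'' s - F' s / s) / 2).
  assert (HLs := HL s Hs).
  assert (EF'' : F'' s = Lambda F' F'' s * (F' s / s)) by (unfold Lambda; field; lra).
  assert (Hq : 0 < F' s / s) by (apply Rdiv_lt_0_compat; auto).
  assert (HP : 0 < P) by (unfold P; rewrite EF''; nra).
  assert (EQP : (Lambda F' F'' s - 1) / (Lambda F' F'' s + 1) = Q / P).
  { unfold P, Q. rewrite EF''. set (La := Lambda F' F'' s) in *. field.
    repeat split; apply Rgt_not_eq; nra. }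
  assert (Eres : residual F' F'' f z
                 = (B + RtoC (Q / P) * (f z / Cconj (f z)) * Cconj A)%C).
  { unfold residual. fold s. rewrite EQP, (d_zbar_expansion f z A B HE).
    rewrite (d_zbar_expansion _ z _ _ (real_expansion_conj f z A B HE)). reflexivity. }
  pose (e := eps / 4). assert (He : 0 < e) by (unfold e; lra).
  pose (M0 := Cmod A + Cmod B).
  assert (HM0 : 0 <= M0) by (unfold M0; generalize (Cmod_ge_0 A) (Cmod_ge_0 B); lra).
  destruct (constant_fit_descent F F' Lminus Lplus M0 e W HLm HG HM0 He)
    as [eta1 [Heta1 Hconst]].
  destruct (linear_fit_descent F F' (f z) A B (F'' s) e W Hfz (Hder s Hs) He HP)
    as [eta2 [r0 [Heta2 [Hr0 Hlin]]]].
  fold s P Q in Hlin. rewrite <- Eres in Hlin.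
  set (g0 := residual F' F'' f z) in *.
  pose (eta := Rmin eta1 eta2).
  assert (Heta : 0 < eta) by (apply Rmin_glb_lt; auto).
  destruct (HE eta Heta) as [del1 [Hdel1 Hexp]].
  destruct (locally_disk z Omega (Hopen z Hz)) as [del2 [Hdel2 HO]].
  assert (Hdel : 0 < Rmin r0 (Rmin del1 del2))
    by (repeat apply Rmin_glb_lt; auto).
  exists (mkposreal _ Hdel). intros r Hrb Hr.
  change (Rabs (r - 0) < Rmin r0 (Rmin del1 del2)) in Hrb.
  rewrite Rminus_0_r, Rabs_right in Hrb by lra.
  assert (Hr1 : r < r0) by (eapply Rlt_le_trans; [exact Hrb|apply Rmin_l]).
  assert (Hr2 : r < del1).
  { eapply Rlt_le_trans; [exact Hrb|]. eapply Rle_trans; [apply Rmin_r|apply Rmin_l]. }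
  assert (Hr3 : r < del2).
  { eapply Rlt_le_trans; [exact Hrb|]. eapply Rle_trans; [apply Rmin_r|apply Rmin_r]. }
  assert (Hru : forall u, Cmod u = 1 -> Cmod (RtoC r * u) = r)
    by (intros u Hu; rewrite Cmod_real_mult, Hu; lra).
  pose (L := fun u => (A * u + B * Cconj u)%C).
  pose (h := fun u => f (z + RtoC r * u)%C).
  assert (HLM : forall u, Cmod u = 1 -> Cmod (L u) <= M0).
  { intros u Hu. unfold L, M0. eapply Rle_trans; [apply Cmod_triangle|].
    rewrite !Cmod_mult, Cmod_conj, Hu. lra. }
  assert (Hh : forall u, Cmod u = 1 -> Cmod (h u - f z - RtoC r * L u) <= eta * r).
  { intros u Hu. generalize (Hexp (RtoC r * u)%C). rewrite (Hru u Hu).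
    intros H. specialize (H Hr2).
    replace (RtoC r * L u)%C with (A * (RtoC r * u) + B * Cconj (RtoC r * u))%C
      by (unfold L; apply C_eq; unfold Re, Im; simpl; ring). exact H. }
  destruct (circle_fitting_data Omega f z r (eta * r + r * M0 + s) Hf Hr) as [D1 D2].
  { intros u Hu. apply HO. rewrite (Hru u Hu). exact Hr3. }
  { intros u Hu. change (Cmod (h u) <= eta * r + r * M0 + s).
    replace (h u) with ((h u - f z - RtoC r * L u) + RtoC r * L u + f z)%C by ring.
    eapply Rle_trans; [apply Cmod_triangle|]. apply Rplus_le_compat_r.
    eapply Rle_trans; [apply Cmod_triangle|]. apply Rplus_le_compat; [auto|].
    rewrite Cmod_real_mult by lra. apply Rmult_le_compat_l; [lra|auto]. }
  fold h in D1, D2.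
  destruct (unique_min_near (radial_energy F h (fun _ => RtoC 1)) (f z) (r * e))
    as [m1 [U1 N1]].
  { apply (radial_energy_strictly_convex F F' h _ _ _ W D1). }
  { apply (radial_energy_lipschitz F F' h _ _ _ W D1). }
  { apply Rmult_lt_0_compat; auto. }
  { apply (Hconst r _ h L (f z) Hr D1); auto.
    - intros u. unfold L. apply C_eq; unfold Re, Im; simpl; ring.
    - intros u Hu. eapply Rle_trans; [apply Hh, Hu|].
      apply Rmult_le_compat_r; [lra|apply Rmin_l]. }
  destruct (unique_min_near (radial_energy F h (fun u => RtoC r * Cconj u)%C) g0 e)
    as [m2 [U2 N2]]; auto.
  { apply (radial_energy_strictly_convex F F' h _ _ _ W D2). }
  { apply (radial_energy_lipschitz F F' h _ _ _ W D2). }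
  { apply (Hlin r _ h (conj Hr Hr1) D2).
    intros u Hu. eapply Rle_trans; [apply Hh, Hu|].
    apply Rmult_le_compat_r; [lra|apply Rmin_r]. }
  unfold muG.
  rewrite (argminG_eq F f r z m1 m2 _ _ Hr
             (fun a b => Gfun_split F F' f r _ z a b W D1 D2) U1 U2).
  simpl fst. simpl snd.
  replace (m1 + RtoC r * m2 - f z - RtoC r * g0)%C
    with ((m1 - f z) + RtoC r * (m2 - g0))%C by ring.
  eapply Rle_trans; [apply Cmod_triangle|]. rewrite Cmod_real_mult by lra.
  unfold e in N1, N2. nra.
Qed.

Lemma residual_zero_iff (mu : R -> C) (w g : C) :
  (forall eps, 0 < eps ->
     at_right 0 (fun r => Cmod (mu r - w - RtoC r * g) <= eps * r)) ->
  g = 0 <-> (forall eps : posreal, at_right 0 (fun r => Cmod (mu r - w) <= eps * r)).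
Proof.
  intros H. split.
  - intros -> eps. generalize (H eps (cond_pos eps)). apply filter_imp. intros r.
    replace (mu r - w - RtoC r * 0)%C with (mu r - w)%C by ring. auto.
  - intros Hmu. apply NNPP. intro Hg. apply Cmod_gt_0 in Hg.
    assert (He : 0 < Cmod g / 4) by lra.
    generalize (filter_and _ _ (H _ He) (Hmu (mkposreal _ He))). simpl.
    intros [del Hdel].
    pose (r := del / 2).
    assert (Hr : 0 < r) by (unfold r; generalize (cond_pos del); lra).
    destruct (Hdel r) as [K1 K2]; [|exact Hr|].
    { change (Rabs (r - 0) < del).
      rewrite Rminus_0_r, Rabs_right; unfold r in *; lra. }
    assert (K3 : Cmod (RtoC r * g) <= Cmod (mu r - w) + Cmod (mu r - w - RtoC r * g)).
    { replace (RtoC r * g)%C with ((mu r - w) + - (mu r - w - RtoC r * g))%C at 1 by ring.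
      eapply Rle_trans; [apply Cmod_triangle|]. rewrite Cmod_opp. lra. }
    rewrite Cmod_real_mult in K3 by lra. nra.
Qed.

Theorem theorem1p4 (F F' F'' : R -> R)
  (F_nonneg : forall s, 0 <= s -> 0 <= F s)
  (F_derive : forall s, 0 <= s ->
     is_derive_within nonneg_half_line F s (F' s))
  (F'_cont : continuous_on nonneg_half_line F')
  (F'_derive : forall s, 0 < s -> is_derive F' s (F'' s))
  (F''_cont : forall s, 0 < s -> continuous F'' s)
  (F_convex : strictly_convex_on nonneg_half_line F)
  (F_0 : F 0 = 0) (F'_0 : F' 0 = 0)
  (Lminus Lplus : R) (Lminus_pos : 0 < Lminus) (Lminus_le : Lminus <= Lplus)
  (Lambda_bounds : forall s, 0 < s -> Lminus <= Lambda F' F'' s <= Lplus)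
  (c alpha : R) (c_pos : 0 < c) (alpha_pos : 0 < alpha)
  (F'_asymptotic :
     is_domin (at_right 0) (fun s => Rpower s alpha)
       (fun s => F' s - c * Rpower s alpha))
  (Omega : C -> Prop) (Omega_domain : complex_domain Omega)
  (f : C -> C) (f_diff : forall z, Omega z -> real_differentiable f z) :
  (forall z, Omega z -> f z <> RtoC 0 -> satisfies_equation F' F'' f z) <->
  (forall z, Omega z -> f z <> RtoC 0 -> asymptotic_mvp F f z).
Proof.
  assert (W : weight F F') by (apply weight_intro; auto).
  assert (Hz : forall z, Omega z -> f z <> RtoC 0 ->
            satisfies_equation F' F'' f z <-> asymptotic_mvp F f z).
  { intros z Hz Hfz. apply (residual_zero_iff (fun r => muG F f r z)).
    intros eps Heps.
    apply (mean_value_expansion F F' F'' Lminus Lplus Omega); auto. apply Omega_domain. }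
  split; intros H z HOz Hfz; apply Hz; auto.
Qed.
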